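(* Let $G$ be an abelian group. (1) If $\mathcal L (G) = \mathcal L ( C_2^{r-1} \oplus C_4 )$ for some integer $r \ge 2$, then $G \cong C_2^{r-1} \oplus C_4$. (2) If $\mathcal L (G) = \mathcal L ( C_2 \oplus C_{2n} )$ for some integer $n \ge 2$, then $G \cong C_2 \oplus C_{2n}$.
   Context: $C_n$ denotes a cyclic group of order $n$. For an additively written abelian group $G$, a sequence over $G$ is an element $S=g_1\cdot\ldots\cdot g_l$ of the free abelian monoid $\mathcal F(G)$ with basis $G$ (a finite unordered sequence, repetition allowed); it is a zero-sum sequence if $g_1+\dots+g_l=0$. $\mathcal B(G)\subset\mathcal F(G)$ is the monoid of all zero-sum sequences over $G$; its atoms (irreducible elements) are the minimal zero-sum sequences, i.e. nonempty zero-sum sequences with no proper nonempty zero-sum subsequence. For $S\in\mathcal B(G)$, $\mathsf L(S)$ is the set of all $k\in\mathbb N_0$ such that $S$ is a product of $k$ atoms of $\mathcal B(G)$, and $\mathcal L(G)=\{\mathsf L(S): S\in\mathcal B(G)\}$ is the system of sets of lengths. *)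

(* Defs.v *)
From HB Require Import structures.
From mathcomp Require Import all_boot all_order all_algebra.
From mathcomp Require Import finmap multiset.
From mathcomp Require Import boolp classical_sets.

Set Implicit Arguments.
Unset Strict Implicit.
Unset Printing Implicit Defensive.

Import GRing.Theory.
Local Open Scope ring_scope.
Local Open Scope mset_scope.

(* Finite unordered sequences over G are multisets: the product of F(G) is
   `+`, its identity is mset0, and divisibility is `<=`. *)
Definition zero_sum (G : zmodType) (S : {mset G}) : Prop :=
  \sum_(g <- S) g = 0.

Definition minimal_zero_sum (G : zmodType) (S : {mset G}) : Prop :=
  [/\ S <> mset0, zero_sum S &
      forall T : {mset G}, T `<` S -> T <> mset0 -> ~ zero_sum T].

(* The minimal zero-sum sequences are the atoms of the reduced monoid B(G). *)
Lemma minimal_zero_sumP (G : zmodType) (S : {mset G}) :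
  minimal_zero_sum S <->
  [/\ zero_sum S, S <> mset0 &
      forall A B : {mset G}, zero_sum A -> zero_sum B -> S = A `+` B ->
        A = mset0 \/ B = mset0].
Proof.
have sumD (A B : {mset G}) :
    \sum_(g <- A `+` B) g = \sum_(g <- A) g + \sum_(g <- B) g.
  rewrite -big_cat /=; apply/perm_big/allP => x _ /=.
  by rewrite count_cat !count_mem_mset msetE2.
split=> [[S0 zS minS] | [zS S0 irrS]]; split=> //.
- move=> A B zA _ eqS.
  have [->|/eqP A0] := eqVneq A mset0; [by left | right].
  apply: contrapT => B0; apply: (minS A) => //.
  have leAS : A `<=` S by apply/msubsetP => x; rewrite eqS msetE2 leq_addr.
  rewrite mproperEneq leAS andbT eqS.
  apply/eqP => eqA; apply: B0; apply/msetP => x.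
  move/(congr1 (fun M : {mset G} => M x)): eqA.
  by rewrite msetE2 mset0E => /eqP; rewrite -{1}[A x]addn0 eqn_add2l => /eqP.
- move=> T ltTS T0 zT.
  have leTS := mproper_sub ltTS.
  have eqS : S = T `+` (S `\` T) by rewrite msetBDKC.
  have zB : zero_sum (S `\` T).
    by move: zS; rewrite /zero_sum {1}eqS sumD zT add0r.
  case: (irrS _ _ zT zB eqS) => // B0.
  move: ltTS; rewrite {1}eqS B0 msetD0.
  by rewrite mproperEneq eqxx.
Qed.

Definition is_length (G : zmodType) (S : {mset G}) (k : nat) : Prop :=
  exists As : seq {mset G},
    [/\ size As = k, forall A, A \in As -> minimal_zero_sum A &
        S = \big[msetD/mset0]_(A <- As) A].

Definition lengths (G : zmodType) (S : {mset G}) : set nat :=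
  [set k | is_length S k]%classic.

Definition system_of_lengths (G : zmodType) : set (set nat) :=
  [set L | exists2 S : {mset G}, zero_sum S & L = lengths S]%classic.

Definition zmod_isomorphic (G H : zmodType) : Prop :=
  exists f : {additive G -> H}, bijective f.

(* C_2^(r-1) (+) C_4, for r >= 1. *)
Definition C2pow_C4 (r : nat) : zmodType :=
  ({ffun 'I_(r - 1) -> 'Z_2} * 'Z_4)%type.

(* C_2 (+) C_2n, for n >= 1; 'Z_m has order m only when m >= 2. *)
Definition C2_C2n (n : nat) : zmodType := ('Z_2 * 'Z_(2 * n))%type.

(* Main.v *)
From HB Require Import structures.
Require Import Defs.
From mathcomp Require Import all_boot all_order all_algebra.
From mathcomp Require Import finmap multiset.
From mathcomp Require Import boolp classical_sets.
From mathcomp Require Import zify.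

(** Write D(G) for the largest length of an atom over G, and -U for the sequence
of the negatives of the terms of U.

Why the system of sets of lengths determines the group.  If a set of lengths
contains 2, its maximum is at most D(G); and U (-U) factors into the |U| pairs
g (-g), so D(G) is determined by the system
([davenport_le_transfer]).  Moreover, a set of lengths which contains both 2
and D(G) can only be the one of U (-U) for an atom U of length D(G)
([extremal_product]).  The target C_2^(r-1) + C_4, where D = r + 3, has such a
set {2, 4, D} ([C2pow_C4_atom]), and the target C_2 + C_2n, where D = 2n + 1,
has such a set {2, D - 1, D} ([C2_C2n_set]).  So let U be an atom of length
D = D(G) over an arbitrary group G, such that U (-U) has one of these two sets
of lengths; it remains to show that U determines G.

The tool is the notion of a balanced pair: subsequences A, B of U with disjoint
supports and equal sums, with A + B inside U.  If A (-B) is an atom, then U (-U)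
is the product of A (-B), (-A) B and D - |A| - |B| pairs, hence has a
factorization of length 2 + D - |A| - |B| ([balanced_length]).  So |A| + |B| is
D or 3 for the set {2, D - 1, D}, and D or D - 2 for the set {2, 4, D}.
Maximality of |U| produces many balanced pairs: every element of G is a sum of
terms of U, even after removing one copy of a chosen term j ([subsum]).  Applied
to -i, for another term i, this yields a sequence Z of terms of U different
from i which contains j and has sum i, and Z (-i) is an atom
([maximal_balanced]).

For {2, D - 1, D} this says that i = j + k with terms j, k of U, for every j,
unless i has order two.  It follows quickly that U consists of f, g + f and
D - 2 copies of g, with 2f = 0 and (D - 1)g = 0 ([shape_C2_C2n]), and therefore
G is C_2 + C_(D-1).

For {2, 4, D} with D at least 6, taking complements in U gives, for every term
i of order greater than two, a zero-sum sequence with only four terms: one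
copy of i more than U has, and further terms of U.  Two such sequences
which overlap too little would give a balanced pair of size D - 6 or D - 4
([conflict]).  This forces a term e of order four such that all other terms are
elements of order two, or e plus such elements ([shape_C2pow_C4]).  So G is
C_2^q + C_4, and q is known because D(C_2^q + C_4) = q + 4.  For r = 2 both
targets are C_2 + C_4, both sets are {2, 4, 5}, and the first analysis applies.

The Davenport constants of the targets are bounded above as follows.  On
C_2^q + C_4, the indicator function of 0 is a polynomial function of degree at
most q + 3 with values in the field of two elements, so its iterated differences
of order q + 4 vanish ([deg_lt_davenport]).  In C_2 + C_2n, among 2n + 1 elements
one finds n disjoint short subsequences with sums in the subgroup of order n
formed by the doubles, and the pigeonhole principle applies
([davenport_le_C2_C2n]). *)

Set Implicit Arguments.
Unset Strict Implicit.
Unset Printing Implicit Defensive.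

Import GRing.Theory.
Local Open Scope ring_scope.
Local Open Scope mset_scope.

Notation atom := (@minimal_zero_sum _).

(** * Finite sequences as multisets *)

HB.instance Definition _ (K : choiceType) :=
  Monoid.isComLaw.Build {mset K} mset0 (@msetD K)
    (@msetDA K) (@msetDC K) (@mset0D K).

Section Sequences.
Variable G : zmodType.
Implicit Types (A B C S T U V W F : {mset G}) (g h x : G) (k n : nat).

Definition msum S : G := \sum_(g <- S) g.

Lemma mset1E a x : [mset a] x = (x == a) :> nat.
Proof. by rewrite msetnE; case: (x == a). Qed.

Lemma mset2E a b x : [mset a; b] x = ((x == a) + (x == b))%N.
Proof. by rewrite msetE2 !mset1E. Qed.

Lemma perm_msetD A B : perm_eq (A `+` B) (A ++ B).
Proof.
by apply/allP => x _ /=; rewrite count_cat !count_mem_mset msetE2.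
Qed.

Lemma msumD A B : msum (A `+` B) = msum A + msum B.
Proof. by rewrite /msum (perm_big _ (perm_msetD A B)) big_cat. Qed.

Lemma size_msetD A B : size (A `+` B) = (size A + size B)%N.
Proof. by rewrite (perm_size (perm_msetD A B)) size_cat. Qed.

Lemma msum0 : msum mset0 = 0.
Proof. by rewrite /msum enum_mset0 big_nil. Qed.

Lemma size_msetn n a : size (msetn n a : {mset G}) = n.
Proof. by rewrite enum_msetn size_nseq. Qed.

Lemma msum_msetn n a : msum (msetn n a) = a *+ n.
Proof. by rewrite /msum enum_msetn big_nseq; elim: n => //= n ->; rewrite mulrS. Qed.

Lemma msum1 a : msum [mset a] = a.
Proof. by rewrite msum_msetn mulr1n. Qed.

Lemma msumB A B : B `<=` A -> msum (A `\` B) = msum A - msum B.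
Proof.
by move=> le; rewrite -{2}(msetBDKC le) msumD addrC addrA addNr add0r.
Qed.

Lemma size_msetB A B : B `<=` A -> (size (A `\` B) + size B = size A)%N.
Proof. by move=> le; rewrite addnC -size_msetD msetBDKC. Qed.

Lemma size_sub A B : A `<=` B -> (size A <= size B)%N.
Proof. by move=> /size_msetB <-; rewrite leq_addl. Qed.

Lemma sub_size_eq A B : A `<=` B -> (size B <= size A)%N -> A = B.
Proof.
move=> le sz; have := size_msetB le => eq.
have /eqP : (size (B `\` A) = 0)%N by lia.
by rewrite size_mset_eq0 => /eqP B0; rewrite -(msetBDKC le) B0 msetD0.
Qed.

Lemma count_le_size x S : (S x <= size S)%N.
Proof. by rewrite -count_mem_mset seq.count_size. Qed.

Lemma mset_ex S : S <> mset0 -> exists x, (0 < S x)%N.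
Proof.
by have [->//|[x xS] _] := mset_0Vmem S; exists x; rewrite mset_gt0.
Qed.

Lemma neq0_count x S : (0 < S x)%N -> S <> mset0.
Proof. by move=> + S0; rewrite S0 mset0E. Qed.

Definition mopp S : {mset G} := seq_mset (map -%R S).

Lemma moppE S x : mopp S x = S (- x).
Proof.
rewrite /mopp mset_seqE count_map -count_mem_mset; apply: eq_count => y /=.
by rewrite eqr_oppLR.
Qed.

Lemma msum_opp S : msum (mopp S) = - msum S.
Proof.
rewrite /msum (perm_big _ (perm_eq_seq_mset _)) /= big_map.
by rewrite sumrN.
Qed.

Lemma size_opp S : size (mopp S) = size S.
Proof. by rewrite (perm_size (perm_eq_seq_mset _)) size_map. Qed.

Lemma moppK : involutive mopp.
Proof. by move=> S; apply/msetP => x; rewrite !moppE opprK. Qed.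

Lemma mopp0 : mopp mset0 = mset0.
Proof. by apply/msetP => x; rewrite moppE !mset0E. Qed.

Lemma mopp_eq0 S : mopp S = mset0 -> S = mset0.
Proof. by move=> S0; rewrite -[S]moppK S0 mopp0. Qed.

Lemma mopp_sub A B : A `<=` B -> mopp A `<=` mopp B.
Proof. by move/msubsetP => le; apply/msubsetP => x; rewrite !moppE. Qed.

Lemma mopp_subl A B : A `<=` mopp B -> mopp A `<=` B.
Proof. by move/mopp_sub; rewrite moppK. Qed.

(** Minimality in this form is what gets applied: a nonempty zero-sum subsequence of an atom is everything. *)
(** * Atoms *)

Lemma atomP U :
  atom U <-> [/\ msum U = 0, U <> mset0 &
    forall T, T `<=` U -> msum T = 0 -> T <> mset0 -> T = U].
Proof.
split=> [[U0 zU minU]|[zU U0 minU]]; split=> // T.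
  move=> le zT T0; case: (eqVmproper le) => // lt.
  by case: (minU T lt T0).
move=> lt T0 zT; move: (mproper_neq lt).
by rewrite (minU T (mproper_sub lt) zT T0) eqxx.
Qed.

Lemma atom_opp U : atom U -> atom (mopp U).
Proof.
move=> /atomP[zU U0 minU]; apply/atomP; split.
- by rewrite msum_opp zU oppr0.
- by move/mopp_eq0.
move=> T le zT T0; rewrite -(minU (mopp T)) ?moppK //.
- exact: mopp_subl.
- by rewrite msum_opp zT oppr0.
- by move/mopp_eq0.
Qed.

Lemma mset1_sub x S : (0 < S x)%N -> [mset x] `<=` S.
Proof. by rewrite msub1set mset_gt0. Qed.

Lemma mset1_neq0 x : [mset x] <> mset0 :> {mset G}.
Proof. by move/msetP/(_ x); rewrite msetnxx mset0E. Qed.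

Lemma atom_has0 U : atom U -> (0 < U 0%R)%N -> U = [mset 0].
Proof.
move=> /atomP[_ _ minU] U0; symmetry; apply: minU.
- exact: mset1_sub.
- by rewrite msum1.
- exact: mset1_neq0.
Qed.

Lemma atom_neq0 U g : atom U -> (1 < size U)%N -> (0 < U g)%N -> g <> 0.
Proof.
move=> aU sU Ug g0; move: sU; rewrite (@atom_has0 U) ?size_msetn //.
by rewrite -g0.
Qed.

Lemma atom_size_gt0 U : atom U -> (0 < size U)%N.
Proof. by case=> U0 _ _; rewrite lt0n size_mset_eq0; apply/eqP. Qed.

Lemma size_mset2 a b : size ([mset a; b] : {mset G}) = 2%N.
Proof. by rewrite size_msetD !size_msetn. Qed.

Lemma msum2 a b : msum [mset a; b] = a + b.
Proof. by rewrite msumD !msum1. Qed.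

Lemma atom_pair U a b : atom U -> [mset a; b] `<=` U -> a + b = 0 ->
  U = [mset a; b].
Proof.
move=> /atomP[_ _ minU] le ab; rewrite (minU _ le) //; first by rewrite msum2.
by apply: (@neq0_count a); rewrite mset2E eqxx.
Qed.

Lemma atom_pairF U a b : atom U -> (2 < size U)%N -> [mset a; b] `<=` U ->
  a + b <> 0.
Proof.
move=> aU sU le ab.
by move: sU; rewrite (atom_pair aU le ab) size_mset2.
Qed.

Lemma mset2_sub a b U :
  ((a == b) < U a)%N -> ((a == b) < U b)%N -> [mset a; b] `<=` U.
Proof.
move=> Ua Ub; apply/msubsetP => x; rewrite mset2E.
move: Ua Ub; have [->|xa] := eqVneq x a; first by case: (a == b); lia.
by have [->|xb] := eqVneq x b; lia.
Qed.

Lemma atom_pair_opp g : g <> 0 -> atom [mset g; - g].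
Proof.
move=> g0; apply/atomP; split.
- by rewrite msum2 subrr.
- by apply: (@neq0_count g); rewrite mset2E eqxx.
move=> T le zT T0; apply: sub_size_eq => //; rewrite size_mset2 ltnNge.
apply/negP => sT.
have [x Tx] := mset_ex T0.
have eT : T = [mset x].
  by symmetry; apply: sub_size_eq; rewrite ?mset1_sub ?size_msetn.
move: zT; rewrite eT msum1 => x0.
have := msubsetP le x; rewrite mset2E x0 eT x0 mset1E eqxx.
rewrite [0 == - g]eq_sym oppr_eq0 [0 == g]eq_sym.
by move/eqP/negbTE: g0 => ->.
Qed.

Lemma atom_size2 U : atom U -> size U = 2%N -> exists2 g, g <> 0 & U = [mset g; - g].
Proof.
move=> aU sU; have [x Ux] : exists x, (0 < U x)%N by apply: mset_ex; case: aU.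
have le := mset1_sub Ux; have := size_msetB le; rewrite sU size_msetn => sB.
have [y By] : exists y, (0 < (U `\` [mset x]) y)%N.
  by apply: mset_ex => B0; move: sB; rewrite B0 enum_mset0.
have eB : [mset y] = U `\` [mset x].
  by apply: sub_size_eq; rewrite ?mset1_sub ?size_msetn //; lia.
have eU : U = [mset x; y] by rewrite eB msetBDKC.
have [zU _ _] := proj1 (atomP U) aU.
exists x; first by apply: (atom_neq0 aU); rewrite ?sU.
by move/eqP: zU; rewrite eU msum2 addr_eq0 => /eqP ->; rewrite opprK.
Qed.

(** * Factorizations *)

Lemma is_length0 : is_length (mset0 : {mset G}) 0.
Proof. by exists [::]; rewrite big_nil. Qed.

Lemma is_lengthA A : atom A -> is_length A 1.
Proof.
move=> aA; exists [:: A]; split=> //; last by rewrite big_seq1.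
by move=> B; rewrite inE => /eqP ->.
Qed.

Lemma is_lengthD S T k l : is_length S k -> is_length T l ->
  is_length (S `+` T) (k + l)%N.
Proof.
move=> [As [<- aA ->]] [Bs [<- aB ->]]; exists (As ++ Bs).
split; [by rewrite size_cat | | by rewrite big_cat].
by move=> C; rewrite mem_cat => /orP[/aA|/aB].
Qed.

Lemma is_length_pairs S : S 0%R = 0%N -> is_length (S `+` mopp S) (size S).
Proof.
move=> S0.
have {S0}: 0 \notin enum_mset S by rewrite -mset_eq0 S0.
rewrite -{2}[S]seq_mset_id /mopp; elim: (enum_mset S) => [|g s IH] /=.
  have -> : seq_mset [::] = mset0 :> {mset G}.
    by apply/msetP => x; rewrite mset_seqE mset0E.
  by rewrite msetD0 => _; apply: is_length0.
rewrite inE negb_or => /andP[g0 s0].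
rewrite !mset_cons msetDACA.
have -> : (size s).+1 = (1 + size s)%N by [].
apply: is_lengthD (IH s0); apply/is_lengthA/atom_pair_opp.
by apply/eqP; rewrite eq_sym.
Qed.

Lemma lengthsE S k : lengths S k = is_length S k.
Proof. by []. Qed.

Lemma big_msetE (As : seq {mset G}) x :
  (\big[msetD/mset0]_(A <- As) A) x = (\sum_(A <- As) A x)%N.
Proof.
by elim: As => [|A As IH]; rewrite ?big_nil ?mset0E // !big_cons msetE2 IH.
Qed.

Lemma big_msize (As : seq {mset G}) :
  size (\big[msetD/mset0]_(A <- As) A) = (\sum_(A <- As) size A)%N.
Proof.
elim: As => [|A As IH]; first by rewrite !big_nil enum_mset0.
by rewrite !big_cons size_msetD IH.
Qed.

End Sequences.

(** * Balanced pairs *)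

Section Relations.
Variable G : zmodType.
Implicit Types (A B C S T U V W F : {mset G}) (g h x f : G) (k n D : nat).

Definition disjoint_supp A B := forall x, A x = 0%N \/ B x = 0%N.

Lemma disjoint_supp_sub U A B : disjoint_supp A B -> A `<=` U -> B `<=` U -> A `+` B `<=` U.
Proof.
move=> dAB /msubsetP leA /msubsetP leB; apply/msubsetP => x; rewrite msetE2.
by have := leA x; have := leB x; case: (dAB x) => ->; lia.
Qed.

(** A balanced pair encodes a zero-sum subsequence A (-B) of U (-U) which
contains no pair g (-g). *)
Definition balanced U A B :=
  [/\ A `+` B `<=` U, disjoint_supp A B, msum A = msum B & A `+` B <> mset0].

Lemma sub_split T A B : T `<=` A `+` mopp B ->
  exists A' B', [/\ A' `<=` A, B' `<=` B & T = A' `+` mopp B'].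
Proof.
move=> /msubsetP le; exists (T `&` A), (mopp (T `\` (T `&` A))).
have leI := msubsetIl T A.
split; [exact: msubsetIr | | by rewrite moppK msetBDKC].
apply/msubsetP => x; rewrite moppE !msetE2.
by have := le (- x); rewrite msetE2 moppE opprK; lia.
Qed.

(** If g occurred in both A and B, the pair g (-g) would already be a zero-sum
subsequence of W; so the two parts have disjoint supports, and therefore fit
together into U. *)
Lemma atom_split U W : atom W -> size W <> 2%N -> W `<=` U `+` mopp U ->
  exists A B, balanced U A B /\ W = A `+` mopp B.
Proof.
move=> aW sW /sub_split[A [B [leA leB eW]]]; exists A, B; split=> //.
have dAB : disjoint_supp A B.
  move=> x; have [A0|] := posnP (A x); first by left.
  have [B0|] := posnP (B x); first by right.
  move=> Bx Ax; case: sW; rewrite (@atom_pair _ W x (- x)) ?size_mset2 ?subrr //.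
  apply: mset2_sub; rewrite eW msetE2 moppE.
    by have [<-|_] := eqVneq x (- x); lia.
  by rewrite opprK; have [<-|_] := eqVneq x (- x); lia.
split=> //; first exact: disjoint_supp_sub.
  have [zW _ _] := proj1 (atomP W) aW.
  by move/eqP: zW; rewrite eW msumD msum_opp subr_eq0 => /eqP.
move=> AB0; case: aW => W0 _ _; apply: W0; rewrite eW.
apply/msetP => x; rewrite msetE2 moppE mset0E.
move/msetP: AB0 => AB0; have := AB0 x; have := AB0 (- x).
by rewrite !msetE2 !mset0E; lia.
Qed.

Lemma balanced_sub U A B A' B' : balanced U A B -> A' `<=` A -> B' `<=` B ->
  msum A' = msum B' -> A' `+` B' <> mset0 -> balanced U A' B'.
Proof.
move=> [le dAB _ _] leA leB eAB AB0; split=> //.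
- by apply: msubset_trans le; apply: msetDSS.
- move=> x; have := msubsetP leA x; have := msubsetP leB x.
  by case: (dAB x) => ->; lia.
Qed.

(** A zero-sum subsequence of A (-B) is again of this form, so a pair of least
total size inside the given one yields an atom. *)
Lemma balanced_atom U A B : balanced U A B ->
  exists A' B', [/\ A' `<=` A, B' `<=` B, balanced U A' B' & atom (A' `+` mopp B')].
Proof.
have [n] := ubnP (size A + size B); elim: n A B => // n IH A B ltn rAB.
have [aW|naW] := pselect (atom (A `+` mopp B)).
  by exists A, B; split=> //; apply: msubset_refl.
have [le dAB eAB AB0] := rAB.
have [T [leT zT T0 TW]] : exists T, [/\ T `<=` A `+` mopp B, msum T = 0,
    T <> mset0 & T <> A `+` mopp B].
  apply: contrapT => nT; apply: naW; apply/atomP; split.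
  - by rewrite msumD msum_opp eAB subrr.
  - move=> W0; apply: AB0; apply/msetP => x.
    move/msetP: W0 => W0; have := W0 x; have := W0 (- x).
    by rewrite !msetE2 !moppE !mset0E opprK; lia.
  move=> T leT zT T0; apply: contrapT => TW; apply: nT.
  by exists T.
have [A1 [B1 [leA leB eT]]] := sub_split leT.
have ltT : (size A1 + size B1 < size A + size B)%N.
  rewrite -[size B1]size_opp -[size B]size_opp -!size_msetD -eT ltnNge.
  by apply/negP => /(sub_size_eq leT).
have rAB1 : balanced U A1 B1.
  apply: (balanced_sub rAB) => //.
    by move/eqP: zT; rewrite eT msumD msum_opp subr_eq0 => /eqP.
  move=> AB10; apply: T0; rewrite eT; apply/msetP => x.
  move/msetP: AB10 => AB10; have := AB10 x; have := AB10 (- x).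
  by rewrite !msetE2 !moppE !mset0E; lia.
have [|A2 [B2 [leA2 leB2 r2 a2]]] := IH A1 B1 _ rAB1; first by lia.
by exists A2, B2; split=> //; [apply: msubset_trans leA | apply: msubset_trans leB].
Qed.

Lemma atom_count0 U : atom U -> (1 < size U)%N -> U 0%R = 0%N.
Proof.
by move=> aU sU; apply/eqP; rewrite -leqn0 leqNgt; apply/negP => /(atom_neq0 aU sU).
Qed.

(** The complement of A (-B) and of its negative in U (-U) consists of pairs g (-g). *)
Lemma balanced_length U A B : atom U -> (1 < size U)%N -> balanced U A B ->
  atom (A `+` mopp B) ->
  is_length (U `+` mopp U) (2 + (size U - (size A + size B)))%N.
Proof.
move=> aU sU [le dAB eAB AB0] aW.
pose R := U `\` (A `+` B).
have eU : U = (A `+` B) `+` R by rewrite msetBDKC.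
have sR : size R = (size U - (size A + size B))%N.
  by have := size_msetB le; rewrite size_msetD -/R; move: (size R) (size U) => r u; lia.
have -> : U `+` mopp U = (A `+` mopp B) `+` mopp (A `+` mopp B) `+` (R `+` mopp R).
  by apply/msetP => x; rewrite eU !(msetE2, moppE) opprK; lia.
rewrite -sR; apply: is_lengthD.
  have := is_lengthD (is_lengthA aW) (is_lengthA (atom_opp aW)).
  by rewrite addn1.
apply: is_length_pairs.
by rewrite msetE2 (atom_count0 aU sU).
Qed.

Lemma atom_length2 U V : atom U -> atom V -> is_length (U `+` V) 2.
Proof. by move=> aU aV; apply: (is_lengthD (is_lengthA aU) (is_lengthA aV)). Qed.

Lemma balanced_nil U A : atom U -> balanced U A mset0 -> A = U.
Proof.
move=> /atomP[_ _ minU] []; rewrite msetD0 msum0 => le _ zA A0.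
exact: minU.
Qed.

Lemma balancedC U A B : balanced U A B -> balanced U B A.
Proof.
move=> [le d e n]; split=> //; rewrite 1?msetDC //.
by move=> x; case: (d x); [right|left].
Qed.

Lemma factor_sub (As : seq {mset G}) A : A \in As ->
  A `<=` \big[msetD/mset0]_(B <- As) B.
Proof.
move=> AAs; apply/msubsetP => x; rewrite big_msetE (big_rem A) //=.
by rewrite leq_addr.
Qed.

Lemma prod_atom (As : seq {mset G}) V : (forall A, A \in As -> atom A) ->
  atom V -> \big[msetD/mset0]_(A <- As) A = V -> size As = 1%N.
Proof.
case: As => [|A [|B As]] // aAs /atomP[_ V0 minV] eV.
  by case: V0; rewrite -eV big_nil.
have aA := proj1 (atomP A) (aAs A (mem_head _ _)).
have eA : A = V.
  case: aA => zA A0 _; apply: minV => //; rewrite -eV.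
  by apply: factor_sub; rewrite mem_head.
have : atom B by apply: aAs; rewrite !inE eqxx orbT.
move/atom_size_gt0; move/(congr1 (fun S : {mset G} => size S)): eV.
by rewrite !big_cons !size_msetD eA; lia.
Qed.

(** Once A (-B) is split off with A + B = U, what remains of U (-U) is the atom
(-A) B. *)
Lemma full_factor U (As : seq {mset G}) A B : atom (A `+` mopp B) ->
  (forall C, C \in As -> atom C) ->
  \big[msetD/mset0]_(C <- As) C = U `+` mopp U ->
  A `+` mopp B \in As -> A `+` B = U -> size As = 2%N.
Proof.
move=> aW aAs eU WAs eAB.
have := perm_to_rem WAs => pW; rewrite (perm_size pW) /=; congr S.
apply: (@prod_atom _ (mopp (A `+` mopp B))).
- by move=> C /mem_rem; apply: aAs.
- exact: atom_opp.
move: eU; rewrite (perm_big _ pW) /= big_cons /=.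
move: (\big[_/_]_(C <- rem _ _) C) => R /msetP eR.
apply/msetP => x; move: (eR x).
by rewrite -eAB !(msetE2, moppE) opprK; lia.
Qed.

(** A factor of length other than two comes from a balanced pair. *)
Lemma full_lengths U k : atom U -> (2 < size U)%N ->
  (forall A B, balanced U A B -> A `+` B = U) ->
  is_length (U `+` mopp U) k -> k = 2%N \/ k = size U.
Proof.
move=> aU sU full [As [<- aAs eU]].
have [all2|] := pselect (forall W, W \in As -> size W = 2%N).
  right; have := congr1 (fun S : {mset G} => size S) eU.
  rewrite size_msetD size_opp big_msize.
  have -> : (\sum_(A <- As) size A = 2%N * size As)%N; last by lia.
  by rewrite -sum1_size big_distrr /=; apply: eq_big_seq => W /all2 ->.
move/existsNP => [W /not_implyP[WAs sW]]; left.
have aW := aAs W WAs.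
have [|A [B [rAB eW]]] := atom_split aW sW (U := U).
  by rewrite eU; apply: factor_sub.
by apply: (@full_factor U As A B); rewrite -?eW //; apply: full.
Qed.

(** The term f serves as a marker: the long factors are those which contain
exactly one of f, -f.  As U (-U) contains f or -f exactly twice, there are
no long factors or two of them. *)
Lemma lengths_by_marker U l f k : atom U -> (2 < size U)%N -> U f = 1%N ->
  (forall A B, balanced U A B ->
     A `+` B = U \/ ((size A + size B)%N = l /\ (A f + B f)%N = 1%N)) ->
  is_length (U `+` mopp U) k ->
  [\/ k = 2%N, k = size U | (k + l)%N = (size U).+2].
Proof.
move=> aU sU Uf Hrel [As [<- aAs eU]].
have nUf : f <> - f -> U (- f) = 0%N.
  move=> ff; apply/eqP; rewrite -leqn0 leqNgt; apply/negP => Uf'.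
  have /eqP/negbTE ff' := ff.
  apply: (atom_pairF aU sU (a := f) (b := - f)); rewrite ?subrr //.
  by apply: mset2_sub; rewrite ff' ?Uf.
pose c W : nat := (W f + (if f == - f then 0 else W (- f)))%N.
have [[A [B [WAs eAB]]]|nofull] := pselect (exists A B,
    A `+` mopp B \in As /\ A `+` B = U).
  constructor 1; apply: (@full_factor U As A B) => //; exact: aAs.
have Hc W : W \in As ->
    size W = 2%N /\ ~~ odd (c W) \/ size W = l /\ c W = 1%N.
  move=> WAs; have aW := aAs W WAs.
  have [sW|sW] := eqVneq (size W) 2.
    left; split=> //; have [g g0 ->] := atom_size2 aW sW.
    rewrite /c !mset2E; have [ff|_] := eqVneq f (- f).
      have -> : (f == - g) = (f == g) by rewrite -eqr_oppLR -ff.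
      by rewrite addn0; case: (f == g).
    rewrite !eqr_opp [- f == g]eqr_oppLR.
    by case: (f == g); case: (f == - g).
  right; have [|A [B [rAB eW]]] := atom_split aW (elimN eqP sW) (U := U).
    by rewrite eU; apply: factor_sub.
  case: (Hrel A B rAB) => [eAB|[sAB fAB]].
    by case: nofull; exists A, B; rewrite -eW.
  split; first by rewrite eW size_msetD size_opp.
  rewrite /c eW !(msetE2, moppE) opprK.
  have [<-|/eqP ff] := eqVneq f (- f); first by lia.
  case: rAB => /msubsetP/(_ (- f)); rewrite msetE2 nUf //; lia.
have [n1 [n2 [m [e1 e2 e3]]]] : exists n1 n2 m, [/\ size As = n1 + n2,
    \sum_(W <- As) size W = l * n1 + 2 * n2 &
    \sum_(W <- As) c W = n1 + 2 * m]%N.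
  elim: As Hc {aAs eU nofull} => [|W As IH] Hc.
    by exists 0%N, 0%N, 0%N; rewrite !big_nil /=; split; lia.
  have [|n1 [n2 [m [e1 e2 e3]]]] := IH.
    by move=> V VAs; apply: Hc; rewrite inE VAs orbT.
  rewrite !big_cons /= e1 e2 e3.
  case: (Hc W (mem_head _ _)) => [[-> cW]|[-> ->]].
    exists n1, n2.+1, (m + (c W)./2)%N; split; try lia.
  by exists n1.+1, n2, m; split; lia.
(* Here n1 is the number of long factors; it is even and at most 2. *)
have e4 : (\sum_(W <- As) c W = 2)%N.
  have -> : (\sum_(W <- As) c W = c (U `+` mopp U))%N.
    have -> : c (U `+` mopp U) = ((U `+` mopp U) f + (U `+` mopp U) (- f) * (f != - f))%N.
      by rewrite /c; case: (f == - f); rewrite ?muln0 ?muln1.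
    rewrite eU !big_msetE big_distrl -big_split /=; apply: eq_bigr => W _.
    by rewrite /c; case: (f == - f); rewrite ?muln0 ?muln1.
  rewrite /c !(msetE2, moppE) opprK Uf.
  have [<-|/eqP ff] := eqVneq f (- f); first by rewrite Uf.
  by rewrite nUf.
have e5 : (\sum_(W <- As) size W = size U + size U)%N.
  by rewrite -big_msize -eU size_msetD size_opp.
have : n1 = 0%N \/ n1 = 2%N by lia.
case=> n1E; first by constructor 2; lia.
by constructor 3; lia.
Qed.

End Relations.

(** * Davenport constants and sets of lengths *)

Section Davenport.
Variable G : zmodType.
Implicit Types (A B C S T U V W F : {mset G}) (g h x f : G) (k n D : nat).

(** The Davenport constant of G is at most D. *)
Definition davenport_le D := forall U, atom U -> (size U <= D)%N.

(** Counting 0 twice gives every atom weight at least 2, including the atom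
formed by 0 alone, so that a factorization has at most half the weight as its
length. *)
Definition weight S := (size S + S 0%R)%N.

Lemma weight_atom U : atom U -> (2 <= weight U)%N.
Proof.
move=> aU; have := atom_size_gt0 aU; rewrite /weight.
have [sU|] := leqP (size U) 1; last by lia.
have [zU U0 _] := proj1 (atomP U) aU; have [x Ux] := mset_ex U0.
have eU : [mset x] = U by apply: sub_size_eq; rewrite ?mset1_sub ?size_msetn.
by move: zU; rewrite -eU msum1 => ->; rewrite msetnxx size_msetn.
Qed.

Lemma weight_atom_le U D : atom U -> davenport_le D -> (2 <= D)%N -> (weight U <= D)%N.
Proof.
move=> aU dD D2; rewrite /weight; have [U0|] := posnP (U 0%R).
  by rewrite U0 addn0; apply: dD.
by move/(atom_has0 aU) ->; rewrite size_msetn msetnxx.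
Qed.

Lemma weight_big (As : seq {mset G}) :
  weight (\big[msetD/mset0]_(A <- As) A) = (\sum_(A <- As) weight A)%N.
Proof. by rewrite /weight big_msize big_msetE big_split. Qed.

Lemma length2P S : is_length S 2 -> exists U V, [/\ atom U, atom V & S = U `+` V].
Proof.
move=> [As [sAs aAs ->]].
case: As sAs aAs => [|U [|V [|? ?]]] //= _ aAs; exists U, V.
by rewrite !big_cons big_nil msetD0; split=> //; apply: aAs; rewrite !inE eqxx ?orbT.
Qed.

Lemma length_weight S k : is_length S k -> (2 * k <= weight S)%N.
Proof.
move=> [As [<- aAs ->]]; rewrite weight_big -sum1_size big_distrr /=.
rewrite big_seq [X in (_ <= X)%N]big_seq; apply: leq_sum => A /aAs.
exact: weight_atom.
Qed.

Lemma length_le_davenport S k D : davenport_le D -> (2 <= D)%N -> is_length S 2 -> is_length S k ->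
  (k <= D)%N.
Proof.
move=> dD D2 /length2P[U [V [aU aV eS]]] /length_weight.
have := weight_atom_le aU dD D2; have := weight_atom_le aV dD D2.
by rewrite eS /weight size_msetD msetE2; lia.
Qed.

Lemma davenport_leP D : (2 <= D)%N ->
  (forall S k, zero_sum S -> is_length S 2 -> is_length S k -> (k <= D)%N) ->
  davenport_le D.
Proof.
move=> D2 H U aU; have [|sU] := leqP (size U) 1; first by lia.
apply: (H (U `+` mopp U)).
- by have [zU _ _] := proj1 (atomP U) aU; rewrite /zero_sum -/(msum _) msumD msum_opp subrr.
- exact/atom_length2/atom_opp.
- exact/is_length_pairs/atom_count0.
Qed.

(** The weights leave no slack: U and V have length D and every factor of the
second factorization is a pair g (-g).  So S is symmetric, and as neither U nor
V contains a pair g (-g), V has to be -U. *)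
Lemma extremal_product S D : davenport_le D -> (3 <= D)%N -> is_length S 2 -> is_length S D ->
  exists U, [/\ atom U, size U = D & S = U `+` mopp U].
Proof.
move=> dD D3 /length2P[U [V [aU aV eS]]] [As [sAs aAs eAs]].
have D2 : (2 <= D)%N by lia.
have wU := weight_atom_le aU dD D2; have wV := weight_atom_le aV dD D2.
have wS : weight S = (weight U + weight V)%N.
  by rewrite eS /weight size_msetD msetE2; lia.
have w2 W : W \in As -> weight W = 2%N.
  move=> WAs; apply/eqP; rewrite eqn_leq (weight_atom (aAs _ WAs)) andbT leqNgt.
  apply/negP => W3.
  have : (2 * size As < weight S)%N.
    rewrite eAs weight_big (big_rem W) //=.
    have /= := perm_size (perm_to_rem WAs) => ->.
    rewrite mulnS -addSn; apply: leq_add => //.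
    rewrite -sum1_size big_distrr /= big_seq [X in (_ <= X)%N]big_seq.
    by apply: leq_sum => A /mem_rem /aAs; apply: weight_atom.
  by lia.
have wSD : weight S = (2 * D)%N.
  rewrite eAs weight_big -sAs -sum1_size big_distrr /=.
  by apply: eq_big_seq => W /w2.
have U0 : U 0%R = 0%N.
  apply/eqP; rewrite -leqn0 leqNgt; apply/negP => /(atom_has0 aU) eU.
  by move: wU wV wS wSD; rewrite eU /weight size_msetn msetnxx; lia.
have V0 : V 0%R = 0%N.
  apply/eqP; rewrite -leqn0 leqNgt; apply/negP => /(atom_has0 aV) eV.
  by move: wU wV wS wSD; rewrite eV /weight size_msetn msetnxx; lia.
have sU : size U = D by move: wU wV wS wSD; rewrite /weight U0 V0; lia.
have sV : size V = D by move: wU wV wS wSD; rewrite /weight U0 V0; lia.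
exists U; split=> //; rewrite eS; congr (_ `+` _).
have sym x : S x = S (- x) /\ (x = - x -> ~~ odd (S x)).
  have S0 W : W \in As -> W 0%R = 0%N.
    move=> WAs; have : (W 0%R <= S 0%R)%N.
      by rewrite eAs; apply: (msubsetP (factor_sub WAs) 0).
    by rewrite eS msetE2 U0 V0; lia.
  rewrite eAs !big_msetE; elim: As aAs w2 S0 {sAs eAs} => [|W As IH] aAs w2 S0.
    by rewrite !big_nil.
  rewrite !big_cons; have [|||IH1 IH2] := IH.
  - by move=> A AAs; apply: aAs; rewrite inE AAs orbT.
  - by move=> A AAs; apply: w2; rewrite inE AAs orbT.
  - by move=> A AAs; apply: S0; rewrite inE AAs orbT.
  have := w2 W (mem_head _ _); rewrite /weight S0 ?mem_head // addn0.
  move/(atom_size2 (aAs W (mem_head _ _))) => [g g0 ->].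
  rewrite !mset2E !eqr_opp [- x == g]eqr_oppLR; split; first by lia.
  move=> xx; rewrite oddD negb_add (negbTE (IH2 xx)).
  have -> : (x == - g) = (x == g) by rewrite {1}xx eqr_opp.
  by case: (x == g).
have one W x : atom W -> size W = D -> (x == - x < W x)%N -> W (- x) = 0%N.
  move=> aW sW Wx; apply/eqP; rewrite -leqn0 leqNgt; apply/negP => Wx'.
  apply: (atom_pairF aW (a := x) (b := - x)); rewrite ?subrr ?sW //.
  apply: mset2_sub => //; move: Wx Wx'.
  by have [<-|] := eqVneq x (- x).
apply/msetP => x; rewrite moppE.
have [sx ox] := sym x; move: sx ox; rewrite eS !msetE2.
have HU := one U x aU sU; have HV := one V x aV sV.
have HU' := one U (- x) aU sU; have HV' := one V (- x) aV sV.
rewrite !opprK in HU' HV'.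
have [xx|xx] := eqVneq x (- x).
  rewrite -xx eqxx in HU HV HU' HV' * => _ /(_ erefl).
  by move: HU HV; case: (U x) => [|[|u]]; case: (V x) => [|[|v]] //=; lia.
move=> sx _; rewrite eq_sym (negbTE xx) in HU' HV'; rewrite (negbTE xx) in HU HV.
lia.
Qed.

End Davenport.

Lemma lengths_transfer (G H : zmodType) (S : {mset H}) :
  system_of_lengths G = system_of_lengths H -> zero_sum S ->
  exists2 S' : {mset G}, zero_sum S' & forall k, is_length S' k <-> is_length S k.
Proof.
move=> eGH zS.
have : system_of_lengths H (lengths S) by exists S.
rewrite -eGH => -[S' zS' eS]; exists S' => // k.
by rewrite -!lengthsE eS.
Qed.

Lemma davenport_le_transfer (G H : zmodType) D :
  system_of_lengths G = system_of_lengths H -> (2 <= D)%N -> davenport_le H D -> davenport_le G D.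
Proof.
move=> eGH D2 dH; apply: davenport_leP => // S k zS S2 Sk.
have [S' _ eS] := lengths_transfer (esym eGH) zS.
by apply: (length_le_davenport dH D2 (S := S')); rewrite eS.
Qed.

(** * Atoms of maximal length *)

Section ZeroSumFree.
Variable G : zmodType.
Implicit Types (A B C S T U V W F M E Y Z : {mset G}) (g h x f i j : G) (k n D : nat).

Definition zsfree F := forall T, T `<=` F -> msum T = 0 -> T = mset0.

Lemma sub_addl T F x : T `<=` x +` F ->
  T `<=` F \/ exists2 Y, Y `<=` F & T = x +` Y.
Proof.
move=> /msubsetP le; have [xT|xT] := leqP (T x) (F x).
  left; apply/msubsetP => y; have := le y; rewrite mset1DE.
  by have [->|_] := eqVneq y x.
right; exists (T `\ x).
  by apply/msubsetP => y; have := le y; rewrite mset1DE msetB1E; lia.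
by rewrite msetB1K // -mset_gt0; lia.
Qed.

(** Appending the negative of the sum turns a zero-sum free sequence into an
atom. *)
Lemma zsfree_size F D : davenport_le G D -> zsfree F -> (size F < D)%N.
Proof.
move=> dD fF; pose V := (- msum F) +` F.
have -> : (size F).+1 = size V by rewrite size_msetD size_msetn.
apply: dD; apply/atomP; split.
- by rewrite msumD msum1 addNr.
- by apply: (@neq0_count _ (- msum F)); rewrite mset1DE eqxx.
move=> T leT zT T0; case: (sub_addl leT) => [le|[Y leY eT]].
  by case: T0; apply: fF.
have e0 : F `\` Y = mset0.
  apply: fF; first exact: msubsetDl.
  by move: zT; rewrite eT msumD msum1 msumB // => /eqP; rewrite addr_eq0 eqr_opp => /eqP ->; rewrite subrr.
rewrite eT /V; congr (_ `+` _); apply/eqP; rewrite eqEmsubset leY /=.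
by rewrite -msetB_eq0 e0.
Qed.

Lemma not_zsfree F D : davenport_le G D -> (D <= size F)%N ->
  exists T, [/\ T `<=` F, msum T = 0 & T <> mset0].
Proof.
move=> dD sF; apply: contrapT => nT.
have : zsfree F.
  by move=> T le zT; apply: contrapT => T0; apply: nT; exists T.
by move/(zsfree_size dD); rewrite ltnNge sF.
Qed.

Lemma size_ex S n : size S = n.+1 -> exists x S', S = x +` S' /\ size S' = n.
Proof.
move=> sS; have [|x Sx] := @mset_ex _ S.
  by move=> S0; move: sS; rewrite S0 enum_mset0.
exists x, (S `\ x); split; first by rewrite msetB1K // -mset_gt0.
by have := size_msetB (mset1_sub Sx); rewrite size_msetn; lia.
Qed.

Lemma size1_ex S : size S = 1%N -> exists x, S = [mset x].
Proof.
by move=> /size_ex[x [S' [-> /eqP]]]; rewrite size_mset_eq0 => /eqP ->; exists x; rewrite msetD0.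
Qed.

Lemma msum_double S : (forall x, (0 < S x)%N -> x + x = 0) -> msum S + msum S = 0.
Proof.
move=> S2; rewrite /msum -big_split big1_seq // => x /andP[_ xS].
by apply: S2; rewrite mset_gt0.
Qed.

(** Disjointness excludes the trivial solution A = B = g. *)
Lemma balanced_size_ge3 U A B : atom U -> (2 < size U)%N -> balanced U A B ->
  (3 <= size A + size B)%N.
Proof.
move=> aU sU rAB; have [A0|/eqP A0] := eqVneq A mset0.
  by move: (balancedC rAB); rewrite A0 => /(balanced_nil aU) ->; rewrite enum_mset0.
have [B0|/eqP B0] := eqVneq B mset0.
  by move: rAB; rewrite B0 => /(balanced_nil aU) ->; rewrite enum_mset0 addn0.
have A1 : (0 < size A)%N by rewrite lt0n size_mset_eq0; apply/eqP.
have B1 : (0 < size B)%N by rewrite lt0n size_mset_eq0; apply/eqP.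
rewrite leqNgt; apply/negP => lt3.
have /size1_ex[a eA] : size A = 1%N by lia.
have /size1_ex[b eB] : size B = 1%N by lia.
case: rAB => _ dAB; rewrite eA eB !msum1 => eab _.
by case: (dAB a); rewrite ?eA ?eB ?eab msetnxx.
Qed.

Section Extremal.
Variables (D : nat) (U : {mset G}).
Hypotheses (dD : davenport_le G D) (aU : atom U) (sU : size U = D) (D3 : (3 <= D)%N).

Let sumU : msum U = 0. Proof. by case/atomP: aU. Qed.
Let minU T : T `<=` U -> msum T = 0 -> T <> mset0 -> T = U.
Proof. by case/atomP: aU => _ _; apply. Qed.

(** Replacing one copy of j by -h keeps the length D, so a zero-sum subsequence
appears, and it has to use the new term. *)
Lemma subsum j h : (0 < U j)%N -> exists2 Y, Y `<=` U `\ j & msum Y = h.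
Proof.
move=> Uj; have le1 := mset1_sub Uj.
have [||T [leT zT T0]] := @not_zsfree ((- h) +` (U `\ j)) D.
- exact: dD.
- by rewrite size_msetD size_msetn; have := size_msetB le1; rewrite size_msetn; lia.
case: (sub_addl leT) => [le|[Y leY eT]].
  have eT : T = U by apply: minU => //; apply: msubset_trans le (msubsetDl _ _).
  have := msubsetP le j; rewrite eT msetB1E eqxx; lia.
exists Y => //; move: zT; rewrite eT msumD msum1 => /eqP.
by rewrite addrC subr_eq0 => /eqP.
Qed.

Lemma pairF a b : [mset a; b] `<=` U -> a + b <> 0.
Proof. by apply: atom_pairF => //; rewrite sU. Qed.

Lemma pairF2 a b : (0 < U a)%N -> (0 < U b)%N -> a <> b -> a + b <> 0.
Proof.
by move=> Ua Ub /eqP/negbTE ab; apply: pairF; apply: mset2_sub; rewrite ab.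
Qed.

Lemma order2_count i : (0 < U i)%N -> i + i = 0 -> U i = 1%N.
Proof.
move=> Ui ii; apply/eqP; rewrite eqn_leq Ui andbT leqNgt; apply/negP => U2.
by apply: (@pairF i i) => //; apply: mset2_sub; rewrite eqxx.
Qed.

Lemma mem_neq0 i : (0 < U i)%N -> i <> 0.
Proof. by apply: atom_neq0 => //; rewrite sU; lia. Qed.

(** Write -i as a sum Y of terms of U without one copy of j.  If Y left out some
copy of i, then Y and i would form a zero-sum subsequence missing a copy of j;
so Y contains all copies of i, and Z is its complement. *)
Lemma maximal_balanced i j : (0 < U i)%N -> (0 < U j)%N -> i <> j ->
  exists Z, [/\ Z `<=` U, Z i = 0%N, (0 < Z j)%N, msum Z = i &
    balanced U Z [mset i] /\ atom (Z `+` mopp [mset i])].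
Proof.
move=> Ui Uj ij; have [Y leY sY] := subsum (- i) Uj.
have leYU : Y `<=` U by apply: msubset_trans leY (msubsetDl _ _).
have Yj : (Y j < U j)%N.
  by have := msubsetP leY j; rewrite msetB1E eqxx; lia.
have Yi : Y i = U i.
  apply/eqP; rewrite eqn_leq (msubsetP leYU) /= leqNgt; apply/negP => Yi.
  have le : i +` Y `<=` U.
    apply/msubsetP => x; rewrite mset1DE; have := msubsetP leYU x.
    by have [->|_] := eqVneq x i.
  have : i +` Y = U.
    apply: minU => //; first by rewrite msumD msum1 sY subrr.
    by apply: (@neq0_count _ i); rewrite mset1DE eqxx.
  move/msetP/(_ j); rewrite mset1DE.
  by case: eqVneq => [/esym|_]; [| lia].
exists (U `\` Y).
have leZ : U `\` Y `<=` U by exact: msubsetDl.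
have Zi : (U `\` Y) i = 0%N by rewrite msetE2 Yi subnn.
have Zj : (0 < (U `\` Y) j)%N by rewrite msetE2; lia.
have sZ : msum (U `\` Y) = i by rewrite msumB // sumU sY sub0r opprK.
have r : balanced U (U `\` Y) [mset i].
  split; rewrite ?msum1 //.
  - apply: disjoint_supp_sub => //; last exact: mset1_sub.
    move=> x; rewrite mset1E; have [->|_] := eqVneq x i; by [left | right].
  - move=> x; rewrite mset1E; have [->|_] := eqVneq x i; by [left | right].
  - by apply: (@neq0_count _ j); rewrite msetE2; lia.
split=> //; split=> //.
have [A [B [leA leB rAB aAB]]] := balanced_atom r.
have eB : B = [mset i].
  apply: sub_size_eq leB _; rewrite size_msetn lt0n size_mset_eq0; apply/eqP => B0.
  move: rAB; rewrite B0 => /(balanced_nil aU) eA; move/msubsetP/(_ i): leA.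
  by rewrite eA Zi; lia.
have eA : A = U `\` Y.
  case: rAB => _ _; rewrite eB msum1 => sA _.
  have z0 : (U `\` Y) `\` A = mset0.
    have [//|/eqP n0] := eqVneq ((U `\` Y) `\` A) mset0.
    have leZA : (U `\` Y) `\` A `<=` U `\` Y by exact: msubsetDl.
    have e : (U `\` Y) `\` A = U.
      apply: minU => //; first exact: msubset_trans leZA leZ.
      by rewrite msumB // sZ sA subrr.
    by move/msubsetP/(_ i): leZA; rewrite e Zi; lia.
  by apply/eqP; rewrite eqEmsubset leA /= -msetB_eq0 z0.
by rewrite -eA -eB.
Qed.

Variable a : nat.
Hypothesis HL : forall k, is_length (U `+` mopp U) k <-> [\/ k = 2%N, k = a | k = D].
Hypotheses (a2 : (2 < a)%N) (aD : (a < D)%N).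

Lemma atomic_balanced_size A B : balanced U A B -> atom (A `+` mopp B) ->
  (size A + size B)%N = D \/ (size A + size B + a)%N = D.+2.
Proof.
move=> rAB aAB; have s3 : (3 <= size A + size B)%N.
  by apply: (balanced_size_ge3 aU _ rAB); rewrite sU.
have sle : (size A + size B <= D)%N.
  by case: (rAB) => le _ _ _; rewrite -size_msetD -sU; apply: size_sub.
have sU1 : (1 < size U)%N by rewrite sU; lia.
have := balanced_length aU sU1 rAB aAB; rewrite sU => /HL.
case=> e; [left | right | ]; lia.
Qed.

(** Otherwise U (-U) would have only the lengths 2 and D. *)
Lemma not_all_full : ~ (forall A B, balanced U A B -> A `+` B = U).
Proof.
move=> full; have sU2 : (2 < size U)%N by rewrite sU.
have /(full_lengths aU sU2 full) : is_length (U `+` mopp U) a.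
  by apply/HL; constructor 2.
by rewrite sU; lia.
Qed.

(** If all terms had order two, A + B would have sum zero for every balanced pair,
and would thus be U. *)
Lemma ex_order_gt2 : exists2 g, (0 < U g)%N & g + g <> 0.
Proof.
apply: contrapT => nex; apply: not_all_full => A B rAB.
have U2 x : (0 < U x)%N -> x + x = 0.
  by move=> Ux; apply: contrapT => xx; apply: nex; exists x.
case: rAB => le dAB eAB AB0; apply: minU => //.
rewrite msumD -eAB; apply: msum_double => x Ax; apply: U2.
by have := msubsetP le x; rewrite msetE2; lia.
Qed.

Lemma ex_other g : exists2 j, (0 < U j)%N & j <> g.
Proof.
apply: contrapT => nex; apply: not_all_full => A B rAB.
have U0 x : x <> g -> U x = 0%N.
  move=> xg; apply/eqP; rewrite -leqn0 leqNgt; apply/negP => Ux.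
  by apply: nex; exists x.
case: (rAB) => le dAB _ _.
have AB x : x <> g -> A x = 0%N /\ B x = 0%N.
  by move=> xg; have := msubsetP le x; rewrite msetE2 U0 //; lia.
case: (dAB g) => e0.
  have eA : A = mset0.
    apply/msetP => x; rewrite mset0E; have [->//|/eqP xg] := eqVneq x g.
    by case: (AB x xg).
  by move: (balancedC rAB); rewrite eA mset0D => /(balanced_nil aU).
have eB : B = mset0.
  apply/msetP => x; rewrite mset0E; have [->//|/eqP xg] := eqVneq x g.
  by case: (AB x xg).
by move: rAB; rewrite eB msetD0 => /(balanced_nil aU).
Qed.

(** The alternative size D for the pair (Z, i) means that Z is U without i, and
then i = -i. *)
Lemma maximal_sum i j : (0 < U i)%N -> (0 < U j)%N -> i <> j -> i + i <> 0 ->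
  exists Z, [/\ Z `<=` U, Z i = 0%N, (0 < Z j)%N, msum Z = i &
    (size Z + a)%N = D.+1].
Proof.
move=> Ui Uj ij ii; have [Z [leZ Zi Zj sZ [rZ aZ]]] := maximal_balanced Ui Uj ij.
exists Z; split=> //; case: (atomic_balanced_size rZ aZ); rewrite size_msetn; last by lia.
move=> sz; case: ii.
have le1 := mset1_sub Ui.
have le : Z `<=` U `\ i.
  apply/msubsetP => x; rewrite msetB1E; have [->|_] := eqVneq x i; first by rewrite Zi.
  by rewrite subn0; apply: msubsetP.
have eZ : Z = U `\ i.
  by apply: sub_size_eq le _; have := size_msetB le1; rewrite size_msetn; lia.
by move: sZ; rewrite eZ msumB // sumU msum1 sub0r => e; rewrite -{1}e addNr.
Qed.

End Extremal.
End ZeroSumFree.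

Lemma mset3_sub (G : zmodType) (U : {mset G}) x y z :
  (0 < U x)%N -> (0 < U y)%N -> (0 < U z)%N -> x <> y -> y <> z -> x <> z ->
  [mset x; y; z] `<=` U.
Proof.
move=> Ux Uy Uz /eqP xy /eqP yz /eqP xz; apply/msubsetP => w.
rewrite msetE2 mset2E mset1E.
have [->|wx] := eqVneq w x; first by rewrite (negbTE xy) (negbTE xz).
have [->|wy] := eqVneq w y; first by rewrite (negbTE yz).
by have [->|wz] := eqVneq w z.
Qed.

(** * The set of lengths {2, D - 1, D} *)

Section Lengths2PredD.
Variable (G : zmodType) (D : nat) (U : {mset G}).
Hypotheses (dD : davenport_le G D) (aU : atom U) (sU : size U = D) (D5 : (5 <= D)%N).
Hypothesis HL : forall k, is_length (U `+` mopp U) k <-> [\/ k = 2%N, k = D.-1 | k = D].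

Let D3 : (3 <= D)%N. Proof. lia. Qed.
Let a2 : (2 < D.-1)%N. Proof. lia. Qed.
Let aD : (D.-1 < D)%N. Proof. lia. Qed.
Let minU T : T `<=` U -> msum T = 0 -> T <> mset0 -> T = U.
Proof. by case/atomP: aU => _ _; apply. Qed.

(** The two sizes allowed are D, excluded because i has order greater than two,
and 3. *)
Lemma split_sum (i j : G) : (0 < U i)%N -> (0 < U j)%N -> i <> j -> i + i <> 0 ->
  exists k, [/\ j + k = i, [mset j; k] `<=` U, (0 < U k)%N & k <> i].
Proof.
move=> Ui Uj ij ii.
have [Z [leZ Zi Zj sZ sz]] := maximal_sum dD aU sU D3 HL a2 aD Ui Uj ij ii.
have eZ := msetB1K (_ : j \in Z); rewrite -mset_gt0 in eZ.
have /size1_ex[k ek] : size (Z `\ j) = 1%N.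
  by have := size_msetB (mset1_sub Zj); rewrite size_msetn; lia.
have {eZ}eZ : Z = [mset j; k] by rewrite -ek eZ.
exists k; split.
- by rewrite -sZ eZ msum2.
- by rewrite -eZ.
- by have := msubsetP leZ k; rewrite eZ mset2E eqxx; lia.
- by move=> ki; move: Zi; rewrite eZ mset2E ki eqxx; lia.
Qed.

Lemma three_full x y z : (0 < U x)%N -> (0 < U y)%N -> (0 < U z)%N ->
  x <> y -> y <> z -> x <> z -> x + y + z <> 0.
Proof.
move=> Ux Uy Uz xy yz xz s0.
have e : [mset x; y; z] = U.
  apply: minU; first exact: mset3_sub.
    by rewrite msumD msum2 msum1.
  by apply: (@neq0_count _ x); rewrite msetE2 mset2E eqxx.
by have := sU; rewrite -e size_msetD size_mset2 size_msetn; lia.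
Qed.

(** Two terms of order greater than two differ by a term of order two, and adding
a term of order two to a term of order greater than two gives a term again.
Two terms of order two would then produce a third, namely their sum; so there is
only one, f, and the other terms are g and g + f.  If both were repeated, then
2g = 2(g + f) would be a balanced pair of size four. *)
Theorem shape_C2_C2n : exists f g, [/\ f + f = 0, g *+ D.-1 = 0, g + g <> 0 &
  U = [mset f; g + f] `+` msetn D.-2 g].
Proof.
have pF := @pairF2 G D U aU sU D3.
have [g Ug g2] := ex_order_gt2 aU sU D3 HL a2 aD.
have [j Uj jg] := ex_other aU sU D3 HL a2 aD g.
have double k l : (0 < U k)%N -> (0 < U l)%N -> k + l = 0 -> k + k = 0.
  move=> Uk Ul kl; have [ekl|/eqP nkl] := eqVneq k l; first by rewrite {2}ekl.
  by case: (pF k l).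
have N2 i i' : (0 < U i)%N -> (0 < U i')%N -> i <> i' -> i + i <> 0 -> i' + i' <> 0 ->
    exists k, [/\ (0 < U k)%N, k + k = 0 & i = i' + k].
  move=> Ui Ui' ii' i2 i2'.
  have [k [ek _ Uk _]] := split_sum Ui Ui' ii' i2.
  have [l [el _ Ul _]] := split_sum Ui' Ui (nesym ii') i2'.
  exists k; split=> //; apply: (double k l) => //.
  by apply: (addrI i'); rewrite addrA ek el addr0.
have [f Uf f2] : exists2 f, (0 < U f)%N & f + f = 0.
  have [j2|/eqP j2] := eqVneq (j + j) 0; first by exists j.
  by have [k [Uk k2 _]] := N2 g j Ug Uj (nesym jg) g2 j2; exists k.
have fg : g <> f by move=> e; apply: g2; rewrite e.
have [h [eh _ Uh hg]] := split_sum Ug Uf fg g2.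
have hE : h = g + f by rewrite -eh addrC addrA f2 add0r.
have fN0 := mem_neq0 aU sU D3 Uf.
have gN0 := mem_neq0 aU sU D3 Ug.
have h2 : h + h <> 0 by rewrite hE addrACA f2 addr0.
have hf : h <> f by move=> e; apply: gN0; rewrite -eh e.
(* Otherwise x + f is a term too, and x, f, x + f sum to zero. *)
have ord2 x : (0 < U x)%N -> x + x = 0 -> x = f.
  move=> Ux x2; apply: contrapT => xf.
  have xg : g <> x by move=> e; apply: g2; rewrite e.
  have xN0 := mem_neq0 aU sU D3 Ux.
  have [y [ey _ Uy yg]] := split_sum Ug Ux xg g2.
  have yE : y = g + x by rewrite -ey addrC addrA x2 add0r.
  have yh : y <> h by rewrite yE hE => /addrI.
  have y2 : y + y <> 0 by rewrite yE addrACA x2 addr0.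
  have [z [ez _ Uz _]] := split_sum Uy Uh yh y2.
  have zE : z = x + f.
    by apply: (addrI h); rewrite ez yE hE -addrA [x + f]addrC [f + (f + x)]addrA f2 add0r.
  apply: (@three_full x f z) => //.
  - by rewrite zE => e; apply: xN0; apply: (addIr f); rewrite -e add0r.
  - by rewrite zE => e; apply: fN0; apply: (addrI x); rewrite -e addr0.
  - by rewrite zE addrACA x2 f2 addr0.
have sup x : (0 < U x)%N -> [\/ x = f, x = g | x = h].
  move=> Ux; have [x2|/eqP x2] := eqVneq (x + x) 0.
    by constructor 1; apply: ord2.
  have [->|/eqP xg] := eqVneq x g; first by constructor 2.
  constructor 3; have [k [Uk k2 ->]] := N2 x g Ux Ug xg x2 g2.
  by rewrite hE (ord2 k).
have Uf1 : U f = 1%N by apply: (order2_count aU sU D3).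
(* The roles of g and h = g + f can be exchanged, because g = h + f. *)
have fin g' h' : g' <> f -> h' <> f -> g' <> h' -> h' = g' + f -> g' + g' <> 0 ->
    (forall x, (0 < U x)%N -> [\/ x = f, x = g' | x = h']) -> U h' = 1%N ->
    exists f g, [/\ f + f = 0, g *+ D.-1 = 0, g + g <> 0 &
      U = [mset f; g + f] `+` msetn D.-2 g].
  move=> g'f h'f gh eh' g2' sup' Uh'; exists f, g'.
  have eU : U = [mset f; h'] `+` msetn (U g') g'.
    apply/msetP => x; rewrite msetE2 mset2E msetnE.
    have [->|/eqP xf] := eqVneq x f.
      move/eqP/negbTE: h'f; rewrite eq_sym => ->.
      by move/eqP/negbTE: g'f; rewrite eq_sym => ->; rewrite Uf1.
    have [->|/eqP xh] := eqVneq x h'.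
      by move/eqP/negbTE: gh; rewrite eq_sym => ->; rewrite Uh'.
    have [->|/eqP xg] := eqVneq x g'; first by [].
    by have [//|/sup'[]//] := posnP (U x).
  have Ug' : U g' = D.-2.
    by move: sU; rewrite eU size_msetD size_mset2 size_msetn msetE2 mset2E msetnxx; move/eqP/negbTE: g'f => ->; move/eqP/negbTE: gh => ->; lia.
  rewrite Ug' eh' in eU; split=> //.
  have [zU _ _] := proj1 (atomP U) aU.
  move: zU; rewrite eU msumD msum2 msum_msetn addrA [f + _]addrC -[g' + f + f]addrA f2 addr0 -mulrS.
  by have -> : D.-2.+1 = D.-1 by lia.
have [Ug1|Ug1] := leqP (U g) 1.
  apply: (fin h g) => //; try by [lia|apply/nesym].
  - by rewrite -eh addrC.
  - by move=> x /sup[]; [constructor 1 | constructor 3 | constructor 2].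
have [Uh1|Uh1] := leqP (U h) 1.
  by apply: (fin g h) => //; [apply/nesym | lia].
exfalso.
have r : balanced U (msetn 2 g) (msetn 2 h).
  have dgh : disjoint_supp (msetn 2 g) (msetn 2 h).
    move=> x; rewrite !msetnE; have [->|_] := eqVneq x g; last by left.
    by right; move/eqP/negbTE: hg; rewrite eq_sym => ->.
  split=> //.
  - apply: disjoint_supp_sub => //; apply/msubsetP => x; rewrite msetnE.
      by have [->|_] := eqVneq x g.
    by have [->|_] := eqVneq x h.
  - by rewrite !msum_msetn !mulr2n hE addrACA f2 addr0.
  - by apply: (@neq0_count _ g); rewrite msetE2 msetnxx.
have [A [B [leA leB rAB aAB]]] := balanced_atom r.
have sA := size_sub leA; have sB := size_sub leB; rewrite !size_msetn in sA sB.
have AE : A = msetn (size A) g.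
  have A0 x : x <> g -> A x = 0%N.
    by move=> /eqP/negbTE xg; have := msubsetP leA x; rewrite msetnE xg; lia.
  have eA : A = msetn (A g) g.
    apply/msetP => x; rewrite msetnE; have [->//|/eqP xg] := eqVneq x g.
    exact: A0.
  by rewrite {2}eA size_msetn.
have BE : B = msetn (size B) h.
  have B0 x : x <> h -> B x = 0%N.
    by move=> /eqP/negbTE xg; have := msubsetP leB x; rewrite msetnE xg; lia.
  have eB : B = msetn (B h) h.
    apply/msetP => x; rewrite msetnE; have [->//|/eqP xg] := eqVneq x h.
    exact: B0.
  by rewrite {2}eB size_msetn.
case: (rAB) => _ _ eAB _; rewrite AE BE !msum_msetn in eAB.
have := atomic_balanced_size aU sU D3 HL a2 aD rAB aAB.
case=> s3; first by lia.
have : size A = 1%N /\ size B = 2%N \/ size A = 2%N /\ size B = 1%N by lia.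
case=> -[e1 e2]; rewrite e1 e2 mulr1n mulr2n in eAB.
  by apply: gN0; apply: (addrI g); rewrite addr0 [RHS]eAB hE addrACA f2 addr0.
by apply: fg; apply: (addrI g); rewrite eAB hE.
Qed.

End Lengths2PredD.

(** * The set of lengths {2, 4, D} *)

Lemma sum_nseq (G : zmodType) (g : G) n : \sum_(x <- nseq n g) x = g *+ n.
Proof. by rewrite big_nseq; elim: n => //= n ->; rewrite mulrS. Qed.

Lemma mulrn_gcd (G : zmodType) (g : G) m n :
  g *+ m = 0 -> g *+ n = 0 -> g *+ gcdn m n = 0.
Proof.
move=> gm gn; have [->|m0] := posnP m; first by rewrite gcd0n.
have [km kn e _] := egcdnP n m0.
have : g *+ (km * m) = 0 by rewrite mulnC mulrnA gm mul0rn.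
by rewrite e mulrnDr mulnC mulrnA gn mul0rn add0r.
Qed.

Lemma mulrn_dvd (G : zmodType) (g : G) m n : g *+ m = 0 -> (m %| n)%N -> g *+ n = 0.
Proof. by move=> gm /dvdnP[k ->]; rewrite mulnC mulrnA gm mul0rn. Qed.

Lemma count3 (T : eqType) (r : seq T) x y z : x != y -> y != z -> x != z ->
  (count_mem x r + count_mem y r + count_mem z r <= size r)%N.
Proof.
move=> xy yz xz; elim: r => //= t r IH.
have [->|tx] := eqVneq t x; first by rewrite (negbTE xy) (negbTE xz); lia.
have [->|ty] := eqVneq t y; first by rewrite (negbTE yz); lia.
by case: (t == z); lia.
Qed.

Section Lengths24D.
Variable (G : zmodType) (D : nat) (U : {mset G}).
Implicit Types (A B M R Z E F T : {mset G}) (g h x y i j k l e : G) (r : seq G).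
Hypotheses (dD : davenport_le G D) (aU : atom U) (sU : size U = D) (D6 : (6 <= D)%N).
Hypothesis HL : forall n, is_length (U `+` mopp U) n <-> [\/ n = 2%N, n = 4%N | n = D].

Let D3 : (3 <= D)%N. Proof. lia. Qed.
Let a2 : (2 < 4)%N. Proof. by []. Qed.
Let aD : (4 < D)%N. Proof. lia. Qed.
Let sU2 : (2 < size U)%N. Proof. by rewrite sU. Qed.
Let minU T : T `<=` U -> msum T = 0 -> T <> mset0 -> T = U.
Proof. by case/atomP: aU => _ _; apply. Qed.
Let sumU : msum U = 0. Proof. by case/atomP: aU. Qed.

(** Sizes of atomic balanced pairs are D - 2 or D; a second atomic part would not
fit into U. *)
Lemma balanced_sizes A B : balanced U A B ->
  (size A + size B = D \/ size A + size B + 2 = D)%N.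
Proof.
move=> rAB; have [A' [B' [leA leB rAB' aAB']]] := balanced_atom rAB.
have s' := atomic_balanced_size aU sU D3 HL a2 aD rAB' aAB'.
have [le dAB eAB _] := rAB; have [_ _ eAB' _] := rAB'.
have := size_sub le; rewrite size_msetD sU => sle.
have sA := size_msetB leA; have sB := size_msetB leB.
have [n0|/eqP n0] := eqVneq ((A `\` A') `+` (B `\` B')) mset0.
  have : size ((A `\` A') `+` (B `\` B')) = 0%N by rewrite n0 enum_mset0.
  by rewrite size_msetD; lia.
have r2 : balanced U (A `\` A') (B `\` B').
  by apply: (balanced_sub rAB) => //; rewrite ?msubsetDl // !msumB // eAB eAB'.
by have := balanced_size_ge3 aU sU2 r2; lia.
Qed.

(** The terms of U missing in M and the terms of M exceeding U form a balanced
pair, of size D - 8 + 2k where k counts the excess.  For k = 1 or k = 2 this is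
neither D - 2 nor D. *)
Lemma eight_terms M B : msum M = 0 -> size M = 8%N -> B `<=` U -> (size B <= 2)%N ->
  M `<=` U `+` B -> (exists x, (U x < M x)%N) -> False.
Proof.
move=> zM sM leB sB /msubsetP leM [x Ux].
have eUM : U `+` (M `\` U) = M `+` (U `\` M).
  by apply/msetP => y; rewrite !msetE2; lia.
have leMB : M `\` U `<=` B.
  by apply/msubsetP => y; have := leM y; rewrite !msetE2; lia.
have r : balanced U (U `\` M) (M `\` U).
  split.
  - apply/msubsetP => y; have := leM y; have := msubsetP leB y.
    by rewrite !msetE2; lia.
  - by move=> y; rewrite !msetE2; lia.
  - by have := congr1 (@msum G) eUM; rewrite !msumD sumU zM !add0r.
  - by apply: (@neq0_count _ x); rewrite !msetE2; lia.
have := congr1 (fun S : {mset G} => size S) eUM; rewrite /= !size_msetD sM sU => e.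
have s2 := size_sub leMB.
have s1 : (0 < size (M `\` U))%N.
  by apply: leq_trans (count_le_size x _); rewrite msetE2; lia.
by have := balanced_sizes r; lia.
Qed.

(** The sequence i, ..., i, r has four terms and sum zero, and exceeds U by just
one copy of i.  It is the complement in U of the relation between i and the sum
of the sequence Z in [maximal_sum]. *)
Definition deficit i r := [/\ (0 < U i)%N, i \notin r,
  forall x, (count_mem x r <= U x)%N, (size r + U i = 3)%N &
  i *+ (U i).+1 + \sum_(x <- r) x = 0].

Lemma ex_deficit i j : (0 < U i)%N -> (0 < U j)%N -> i <> j -> i + i <> 0 ->
  exists2 r, deficit i r & (count_mem j r < U j)%N.
Proof.
move=> Ui Uj ij ii.
have [Z [leZ Zi Zj sZ sz]] := maximal_sum dD aU sU D3 HL a2 aD Ui Uj ij ii.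
pose R := (U `\` Z) `\` msetn (U i) i.
have le1 : msetn (U i) i `<=` U `\` Z.
  apply/msubsetP => x; rewrite msetnE msetE2.
  by have [->|_] := eqVneq x i; rewrite ?Zi ?subn0.
have Rx x : count_mem x R = if x == i then 0%N else (U x - Z x)%N.
  rewrite count_mem_mset !msetE2 msetnE; have [->|_] := eqVneq x i; last by lia.
  by rewrite Zi; lia.
exists R; last first.
  by rewrite Rx; have [e|_] := eqVneq j i; [case: ij | lia].
split=> //.
- by rewrite -has_pred1 has_count Rx eqxx.
- by move=> x; rewrite Rx; case: eqP => _; lia.
- have := size_msetB le1; have := size_msetB leZ; rewrite size_msetn sU => e1 e2.
  by apply: (etrans e2); lia.
rewrite -/(msum R) msumB // msumB // sumU sZ msum_msetn mulrS sub0r.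
by rewrite addrACA addrN addrN addr0.
Qed.

(** The deficits of i and of i' have eight terms together, and by [eight_terms]
they have to exceed U by more than one copy of each of i and i'. *)
Lemma conflict i r i' r' : deficit i r -> deficit i' r' -> i <> i' ->
  [\/ i \in r', i' \in r |
   exists x, [/\ x <> i, x <> i' & (U x < count_mem x r + count_mem x r')%N]].
Proof.
move=> [Ui ir cr sr zr] [Ui' ir' cr' sr' zr'] /eqP ii'.
have [?|nir'] := boolP (i \in r'); first by constructor 1.
have [?|ni'r] := boolP (i' \in r); first by constructor 2.
constructor 3; apply: contrapT => nx.
have {}nx x : x <> i -> x <> i' -> (count_mem x r + count_mem x r' <= U x)%N.
  by move=> xi xi'; rewrite leqNgt; apply/negP => lt; apply: nx; exists x.
pose s := nseq (U i).+1 i ++ r ++ (nseq (U i').+1 i' ++ r').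
have sx x : seq_mset s x = ((x == i) * (U i).+1 + count_mem x r +
    ((x == i') * (U i').+1 + count_mem x r'))%N.
  by rewrite mset_seqE !count_cat !count_nseq /= addnA [i == x]eq_sym [i' == x]eq_sym.
have ss : size s = 8%N by rewrite !size_cat !size_nseq; lia.
have c0 x t : x \notin t -> count_mem x t = 0%N by move/count_memPn.
apply: (@eight_terms (seq_mset s) [mset i; i']).
- rewrite /msum (perm_big _ (perm_eq_seq_mset _)) !big_cat !sum_nseq /= addrA.
  by rewrite zr add0r zr'.
- by rewrite (perm_size (perm_eq_seq_mset _)) ss.
- by apply: mset2_sub; rewrite (negbTE ii').
- by rewrite size_mset2.
- apply/msubsetP => x; rewrite msetE2 sx mset2E.
  have [->|/eqP xi] := eqVneq x i; first by rewrite (negbTE ii') !c0 //; lia.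
  have [->|/eqP xi'] := eqVneq x i'; first by rewrite !c0 //; lia.
  by have := nx x xi xi'; lia.
- by exists i; rewrite sx eqxx (negbTE ii') !c0 //; lia.
Qed.

Lemma two_le_order i : (2 <= U i)%N -> i + i <> 0.
Proof. by move=> U2 i2; have := order2_count aU sU D3 _ i2; lia. Qed.

Lemma ex_distinct i : exists2 j, (0 < U j)%N & i <> j.
Proof.
by have [j Uj ji] := ex_other aU sU D3 HL a2 aD i; exists j; last exact/nesym.
Qed.

Lemma deficit_le3 i : (2 <= U i)%N -> (U i <= 3)%N.
Proof.
move=> U2; have [j Uj ij] := ex_distinct i.
have [|r [_ _ _ sr _] _] := @ex_deficit i j _ Uj ij (two_le_order U2); by lia.
Qed.

Lemma deficit3 i : U i = 3%N -> deficit i [::].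
Proof.
move=> U3; have [j Uj ij] := ex_distinct i.
have i2 : i + i <> 0 by apply: two_le_order; rewrite U3.
have [|r dr _] := @ex_deficit i j _ Uj ij i2; first by rewrite U3.
have /eqP : size r = 0%N by case: dr; lia.
by move/nilP => er; rewrite -er.
Qed.

(** The freedom in the choice of j forces the remaining term k, which is
determined by i, to be repeated. *)
Lemma deficit2 i : U i = 2%N -> exists2 k, deficit i [:: k] & (2 <= U k)%N.
Proof.
move=> U2; have [j Uj ij] := ex_distinct i.
have i2 : i + i <> 0 by apply: two_le_order; rewrite U2.
have Ui : (0 < U i)%N by rewrite U2.
have d1 j' : (0 < U j')%N -> i <> j' -> exists k, deficit i [:: k] /\ ((k == j') < U j')%N.
  move=> Uj' ij'; have [r dr cr] := ex_deficit Ui Uj' ij' i2.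
  case: r dr cr => [|k [|? ?]] dr cr; try by case: (dr); rewrite /= U2; lia.
  by exists k; split=> //; move: cr; rewrite /= addn0.
have [k [dk _]] := d1 j Uj ij; exists k => //.
have [_ ik ck _ zk] := dk.
have Uk : (0 < U k)%N by have := ck k; rewrite /= eqxx; lia.
have ik' : i <> k by move=> e; move: ik; rewrite e mem_head.
have [k' [[_ _ _ _ zk'] lt]] := d1 k Uk ik'.
have ekk : k' = k by move: (etrans zk' (esym zk)) => /addrI; rewrite !big_seq1.
by move: lt; rewrite ekk eqxx.
Qed.

Lemma deficit1 i j : U i = 1%N -> i + i <> 0 -> (0 < U j)%N -> i <> j ->
  exists k l, deficit i [:: k; l] /\ ((k == j) + (l == j) < U j)%N.
Proof.
move=> U1 i2 Uj ij; have Ui : (0 < U i)%N by rewrite U1.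
have [r dr cr] := ex_deficit Ui Uj ij i2.
case: r dr cr => [|k [|l [|? ?]]] dr cr; try by case: (dr); rewrite /= U1; lia.
by exists k, l; split=> //; move: cr; rewrite /= addn0.
Qed.

Lemma deficitC i k l : deficit i [:: k; l] -> deficit i [:: l; k].
Proof.
move=> [Ui ir cr sr zr]; split=> //.
- by move: ir; rewrite !inE orbC.
- by move=> x; have := cr x; rewrite /=; lia.
- by rewrite -[RHS]zr; congr (_ + _); rewrite !big_cons addrCA.
Qed.

Lemma deficit_mem i r x : deficit i r -> x \in r -> (0 < U x)%N /\ i <> x.
Proof.
move=> [_ ir cr _ _] xr; split; last by move=> e; move: ir; rewrite e xr.
by apply: leq_trans (cr x); rewrite -has_count has_pred1.
Qed.

(** A sequence of length D is not zero-sum free, and a zero-sum subsequence of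
copies of g and of terms of E has to involve g. *)
Lemma power_free n g E : E `<=` U -> E <> U -> (D <= n + size E)%N ->
  (forall c E', (0 < c <= n)%N -> E' `<=` E -> g *+ c + msum E' = 0 -> False) ->
  False.
Proof.
move=> leE neE sE H.
have [|T [leT zT T0]] := @not_zsfree G (msetn n g `+` E) D dD.
  by rewrite size_msetD size_msetn.
rewrite -[E]moppK in leT.
have [A [B [leA leB eT]]] := sub_split leT.
have leB' : mopp B `<=` E by apply: mopp_subl.
have eA : A = msetn (A g) g.
  apply/msetP => x; rewrite msetnE; have [->//|xg] := eqVneq x g.
  by have := msubsetP leA x; rewrite msetnE (negbTE xg); lia.
have [c0|c0] := posnP (A g).
  have eTB : T = mopp B by rewrite eT eA c0 msetn0 mset0D.
  have eTU : T = U.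
    by apply: minU => //; rewrite eTB; apply: msubset_trans leB' leE.
  by apply: neE; apply/eqP; rewrite eqEmsubset leE /= -eTU eTB.
apply: (H (A g) (mopp B)) => //.
  by rewrite c0 /=; have := msubsetP leA g; rewrite msetnxx.
by rewrite -zT eT msumD {2}eA msum_msetn.
Qed.

Section Triple.
Variable e : G.
Hypothesis Ue : U e = 3%N.

Let de : deficit e [::]. Proof. exact: deficit3. Qed.
Let e4 : e *+ 4 = 0.
Proof. by case: de => _ _ _ _; rewrite big_nil addr0 Ue. Qed.
Let e2 : e + e <> 0. Proof. by apply: two_le_order; rewrite Ue. Qed.

Lemma deficit_e i r : deficit i r -> i <> e -> e \in r.
Proof.
move=> dr ie; case: (conflict de dr (nesym ie)) => // -[x [_ _]].
by case: dr => _ _ /(_ x); rewrite /=; lia.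
Qed.

Lemma triple_uniq x : x <> e -> (2 <= U x)%N -> U x = 2%N.
Proof.
move=> xe U2; have := deficit_le3 U2; rewrite leq_eqVlt => /orP[/eqP|]; last by lia.
by move/deficit3/deficit_e => /(_ xe).
Qed.

(** Let g have multiplicity two.  Then 3g = -e, so g has order 12, and conflicts
show that, besides copies of e and g, there is exactly one term h of order
greater than two, while the D - 6 others have order two.  Together with six
copies of g, those others would form a zero-sum free sequence of length D. *)
Lemma triple_no_double g : g <> e -> U g = 2%N -> False.
Proof.
move=> ge Ug.
have g_def x : x <> e -> U x = 2%N -> deficit x [:: e].
  move=> xe Ux; have [k dk _] := deficit2 Ux.
  by move: (deficit_e dk xe); rewrite inE => /eqP ->.
have dg := g_def g ge Ug.
have g3e : g *+ 3 + e = 0 by case: dg => _ _ _ _; rewrite Ug big_seq1.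
have eE : e = - (g *+ 3) by apply/eqP; rewrite -addr_eq0 addrC g3e.
have g12 : g *+ 12 = 0.
  by move: e4; rewrite eE mulNrn -mulrnA => /eqP; rewrite oppr_eq0 => /eqP.
have g4 : g *+ 4 <> 0.
  move=> g4; apply: ge; apply/eqP; rewrite -subr_eq0 eE opprK -mulrS.
  by rewrite g4.
have g6 : g *+ 6 <> 0.
  move=> g6; apply: e2; rewrite eE -opprD -mulrnDr.
  by rewrite g6 oppr0.
have g_uniq x : U x = 2%N -> x <> e -> x = g.
  move=> Ux xe; apply: contrapT => xg.
  case: (conflict dg (g_def x xe Ux) (nesym xg)); rewrite ?inE.
  - by move/eqP.
  - by move/eqP.
  move=> [y [_ _]] /=; have [<-|_] := eqVneq e y; first by rewrite Ue.
  by rewrite !add0n; lia.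
have h_def h : U h = 1%N -> h + h <> 0 -> deficit h [:: e; g].
  move=> Uh h2.
  have he : h <> e by move=> eh; move: Uh; rewrite eh Ue.
  have hg : h <> g by move=> eh; move: Uh; rewrite eh Ug.
  have Ue0 : (0 < U e)%N by rewrite Ue.
  have [k [l [dkl _]]] := deficit1 Uh h2 Ue0 he.
  have gr : g \in [:: k; l].
    case: (conflict dg dkl (nesym hg)) => //.
      by rewrite inE => /eqP.
    move=> [y [_ _]] /=; case: dkl => _ _ /(_ y) /=.
    by have [<-|_] := eqVneq e y; rewrite ?Ue; case: (k == e); case: (l == e); lia.
  have er := deficit_e dkl he.
  move: gr er; rewrite !inE => /orP[/eqP gk|/eqP gl].
    rewrite -gk eq_sym; move/eqP/negbTE: (ge) => -> /= /eqP el.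
    by rewrite el gk; apply: deficitC.
  by rewrite -gl => /orP[/eqP ek|/eqP eg]; [rewrite ek gl | case: ge].
have h_uniq h h' : U h = 1%N -> h + h <> 0 -> U h' = 1%N -> h' + h' <> 0 -> h = h'.
  move=> Uh h2 Uh' h2'; apply: contrapT => hh.
  have := conflict (h_def h Uh h2) (h_def h' Uh' h2') hh.
  case.
  - by rewrite !inE => /orP[] /eqP eh; move: Uh; rewrite eh ?Ue ?Ug.
  - by rewrite !inE => /orP[] /eqP eh; move: Uh'; rewrite eh ?Ue ?Ug.
  move=> [y [_ _]] /=; have [<-|_] := eqVneq e y.
    by move/eqP/negbTE: ge => ->; rewrite Ue.
  by have [<-|_] := eqVneq g y; rewrite ?Ug.
have ord x : (0 < U x)%N -> [\/ x = e, x = g, x + x = 0 | U x = 1%N /\ x + x <> 0].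
  move=> Ux; have [->|/eqP xe] := eqVneq x e; first by constructor 1.
  have [U2|U2] := leqP 2 (U x).
    by constructor 2; apply: g_uniq => //; apply: triple_uniq.
  have [x2|/eqP x2] := eqVneq (x + x) 0; first by constructor 3.
  by constructor 4; split=> //; lia.
(* Without such h, doubling the sum of U gives 14g = 0, and 12g = 0. *)
have [[h [Uh h2]]|noh] := pselect (exists h, U h = 1%N /\ h + h <> 0); last first.
  pose E := U `\` (msetn 3 e `+` msetn 2 g).
  have le : msetn 3 e `+` msetn 2 g `<=` U.
    apply/msubsetP => x; rewrite msetE2 !msetnE.
    have [->|_] := eqVneq x e; first by move/eqP/negbTE: ge; rewrite eq_sym Ue => ->.
    by have [->|_] := eqVneq x g; rewrite ?Ug.
  have E2 x : (0 < E x)%N -> x + x = 0.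
    rewrite /E !msetE2 !msetnE => Ex; have : (0 < U x)%N by lia.
    case/ord => [xe|xg|//|h2]; last by case: noh; exists x.
      by move: Ex; rewrite xe eqxx Ue; lia.
    by move: Ex; rewrite xg eqxx Ug; lia.
  have := msum_double E2; rewrite /E msumB // sumU msumD !msum_msetn sub0r -opprD.
  move/eqP; rewrite oppr_eq0 addrACA -!mulrnDr eE mulNrn -mulrnA => /eqP e14.
  have e18 : g *+ 18 = g *+ 4.
    by move/eqP: e14; rewrite addrC subr_eq0 => /eqP/esym.
  have g14 : g *+ 14 = 0.
    by apply: (addIr (g *+ 4)); rewrite -mulrnDr add0r; exact: e18.
  have := mulrn_gcd g12 g14; rewrite (_ : gcdn 12 14 = 2%N) // => g2.
  by apply: g4; apply: mulrn_dvd g2 _.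
have he : h <> e by move=> eh; move: Uh; rewrite eh Ue.
have hg : h <> g by move=> eh; move: Uh; rewrite eh Ug.
pose X := msetn 3 e `+` msetn 2 g `+` [mset h].
pose E := U `\` X.
have le : X `<=` U.
  apply/msubsetP => x; rewrite !msetE2 !msetnE.
  have [->|_] := eqVneq x e.
    by move/eqP/negbTE: ge; rewrite eq_sym Ue => ->; move/eqP/negbTE: he; rewrite eq_sym => ->.
  have [->|_] := eqVneq x g; last by have [->|_] := eqVneq x h; rewrite ?Uh.
  by move/eqP/negbTE: hg; rewrite eq_sym Ug => ->.
have sE : (size E + 6)%N = D.
  by have := size_msetB le; rewrite sU !size_msetD !size_msetn.
have leE : E `<=` U := msubsetDl _ _.
have E2 x : (0 < E x)%N -> x + x = 0.
  rewrite /E !msetE2 !msetnE => Ex; have : (0 < U x)%N by lia.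
  case/ord => [xe|xg|//|[U1 x2]].
  - by move: Ex; rewrite xe eqxx Ue; lia.
  - by move: Ex; rewrite xg eqxx Ug; lia.
  by move: Ex; rewrite (h_uniq x h) // eqxx Uh; lia.
apply: (@power_free 6 g E leE).
- by move=> eEU; move: sE; rewrite eEU sU; lia.
- by lia.
move=> c E' /andP[c0 c6] leE' z.
have x2 : msum E' + msum E' = 0.
  by apply: msum_double => x Ex; apply: E2; have := msubsetP leE' x; lia.
have gcc : g *+ (c + c) = 0.
  have := congr1 (fun t => t + t) z; rewrite addr0 addrACA x2 addr0.
  by rewrite -mulrnDr.
have g1 := mulrn_gcd g12 gcc.
have [c5|c5] := leqP c 5.
  have : (gcdn 12 (c + c) %| 4)%N || (gcdn 12 (c + c) %| 6)%N.
    by move: c c0 c5 {c6 z gcc g1} => [|[|[|[|[|[|c]]]]]].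
  by case/orP => /(mulrn_dvd g1); [apply: g4 | apply: g6].
(* As 6g = -2e = 2e, the copies of g can be traded for two copies of e. *)
have ec : c = 6%N by lia.
have E'0 : msum ([mset e; e] `+` E') = 0.
  rewrite msumD msum2 -z ec; congr (_ + _).
  apply/eqP; rewrite -subr_eq0 eE -opprD -mulrnDr -opprD oppr_eq0 -mulrnDr.
  by apply/eqP.
have eEU : [mset e; e] `+` E' = U.
  apply: minU => //; last by apply: (@neq0_count _ e); rewrite msetE2 mset2E eqxx.
  apply/msubsetP => x; have := msubsetP leE' x; have := msubsetP le x.
  rewrite /E !msetE2 !msetnE; have [->|_] := eqVneq x e; first by lia.
  by lia.
move/msetP/(_ g): eEU; rewrite msetE2 mset2E Ug; have := msubsetP leE' g.
rewrite /E !msetE2 !msetnE Ug eqxx; move/eqP/negbTE: ge => ->.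
by lia.
Qed.

(** By [conflict] with the deficit of e, which has no further terms, e belongs to
the deficit of every other term of order greater than two. *)
Lemma triple_shape x : (0 < U x)%N -> [\/ x = e, x + x = 0 | (x + e) + (x + e) = 0].
Proof.
move=> Ux; have [->|/eqP xe] := eqVneq x e; first by constructor 1.
have [x2|/eqP x2] := eqVneq (x + x) 0; first by constructor 2.
constructor 3.
have U1 : U x = 1%N.
  apply/eqP; rewrite eqn_leq Ux andbT leqNgt; apply/negP => U2.
  exact: triple_no_double xe (triple_uniq xe U2).
have Ue0 : (0 < U e)%N by rewrite Ue.
have d2 j : (0 < U j)%N -> x <> j -> exists l, deficit x [:: e; l] /\ ((e == j) + (l == j) < U j)%N.
  move=> Uj xj; have [k [l [dkl lt]]] := deficit1 U1 x2 Uj xj.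
  have := deficit_e dkl xe; rewrite !inE => /orP[/eqP ek|/eqP el].
    by exists l; rewrite ek.
  by exists k; rewrite el addnC; split=> //; apply: deficitC.
have [l [dl _]] := d2 e Ue0 xe.
have [le|/eqP le] := eqVneq l e.
  case: dl => _ _ _ _; rewrite le U1 !big_cons big_nil addr0 mulr2n.
  by rewrite addrACA.
have [Ul xl] : (0 < U l)%N /\ x <> l by apply: (deficit_mem dl); rewrite !inE eqxx orbT.
have [l' [dl' lt]] := d2 l Ul xl.
have ell : l' = l.
  case: dl dl' => _ _ _ _ z [_ _ _ _] z'.
  by move: (etrans z' (esym z)); rewrite !big_cons !big_nil !addr0 => /addrI/addrI.
case: (triple_no_double le); apply: (triple_uniq le).
by move: lt; rewrite ell eqxx eq_sym; move/eqP/negbTE: le => ->.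
Qed.

Lemma triple_case : exists e, [/\ e *+ 4 = 0, e + e <> 0 & forall x, (0 < U x)%N ->
  [\/ x = e, x + x = 0 | (x + e) + (x + e) = 0]].
Proof. by exists e; split=> //; apply: triple_shape. Qed.

End Triple.

Section NoTriple.
Hypothesis no3 : forall x, U x <> 3%N.

Let U2P x : (2 <= U x)%N -> U x = 2%N.
Proof. by move=> U2; have := deficit_le3 U2; have := @no3 x; lia. Qed.

(** Here 8i = 0 and 2i = 2k, a balanced pair of size four; so D = 6, but i, ..., i
(six times) is zero-sum free. *)
Lemma no_mutual_deficits i k : U i = 2%N -> U k = 2%N -> deficit i [:: k] -> deficit k [:: i] -> False.
Proof.
move=> Ui Uk [_ ik _ _]; rewrite Ui big_seq1 => i3k [_ _ _ _].
rewrite Uk big_seq1 => k3i; rewrite inE in ik.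
have kE : k = - (i *+ 3) by apply/eqP; rewrite -addr_eq0 addrC i3k.
have i8 : i *+ 8 = 0.
  by move: k3i; rewrite kE mulNrn -mulrnA => /eqP; rewrite addrC subr_eq0 (_ : (3 * 3 = 1 + 8)%N) // mulrnDr mulr1n -{1}[i]addr0 => /eqP/addrI.
have r : balanced U (msetn 2 i) (msetn 2 k).
  have d : disjoint_supp (msetn 2 i) (msetn 2 k).
    move=> x; rewrite !msetnE; have [->|_] := eqVneq x i; last by left.
    by right; rewrite (negbTE ik).
  split=> //.
  - apply: disjoint_supp_sub => //; apply/msubsetP => x; rewrite msetnE.
      by have [->|_] := eqVneq x i; rewrite ?Ui.
    by have [->|_] := eqVneq x k; rewrite ?Uk.
  - rewrite !msum_msetn kE mulNrn -mulrnA; apply/eqP; rewrite -addr_eq0 -mulrnDr.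
    exact/eqP.
  - by apply: (@neq0_count _ i); rewrite msetE2 msetnxx.
have := balanced_sizes r; rewrite !size_msetn => sD.
have eD : D = 6%N by lia.
apply: (@power_free 6 i mset0 (msub0set _)).
- by move=> U0; move: sU2; rewrite -U0 enum_mset0.
- by rewrite enum_mset0 eD.
move=> c E' /andP[c0 c6]; rewrite msubset0 => /eqP ->; rewrite msum0 addr0 => ic.
have := mulrn_gcd i8 ic => i1.
have : i *+ 4 = 0.
  apply: mulrn_dvd i1 _.
  by move: c c0 c6 {ic} => [|[|[|[|[|[|[|c]]]]]]].
move=> i4; move/eqP: ik; apply; rewrite kE; apply/eqP.
by rewrite -addr_eq0 -mulrS i4.
Qed.

(** Passing from i to the remaining term k = -3i of its deficit gives a cycle of
length three among the repeated terms, because of conflicts; so 28i = 0.  All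
other terms have order two and form, with six copies of i, a zero-sum free
sequence of length D. *)
Lemma no_repeated_term i : U i = 2%N -> False.
Proof.
move=> Ui; have [k dk Uk] := deficit2 Ui; have {}Uk := U2P Uk.
have [l dl Ul] := deficit2 Uk; have {}Ul := U2P Ul.
have [m dm Um] := deficit2 Ul; have {}Um := U2P Um.
have [_ ik] : (0 < U k)%N /\ i <> k by apply: (deficit_mem dk); rewrite mem_head.
have [_ kl] : (0 < U l)%N /\ k <> l by apply: (deficit_mem dl); rewrite mem_head.
have [_ lm] : (0 < U m)%N /\ l <> m by apply: (deficit_mem dm); rewrite mem_head.
have [eil|/eqP il] := eqVneq i l; first by apply: (@no_mutual_deficits i k); rewrite // eil.
have emi : m = i.
  case: (conflict dk dm il); rewrite ?inE.
  - by move/eqP.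
  - by move/eqP/esym.
  move=> [x [_ _]] /=; have [<-|_] := eqVneq k x; first by rewrite Uk; case: (m == k).
  by have [<-|_] := eqVneq m x; rewrite ?Um.
rewrite {}emi in dm lm Um.
have z1 : i *+ 3 + k = 0 by case: dk => _ _ _ _; rewrite Ui big_seq1.
have z2 : k *+ 3 + l = 0 by case: dl => _ _ _ _; rewrite Uk big_seq1.
have z3 : l *+ 3 + i = 0 by case: dm => _ _ _ _; rewrite Ul big_seq1.
have kE : k = - (i *+ 3) by apply/eqP; rewrite -addr_eq0 addrC z1.
have lE : l = i *+ 9.
  by apply/eqP; rewrite -subr_eq0 -z2 kE mulNrn -mulrnA addrC.
have i28 : i *+ 28 = 0 by rewrite -z3 lE -mulrnA -mulrSr.
have rest x : (0 < U x)%N -> x <> i -> x <> k -> x <> l -> x + x = 0.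
  move=> Ux xi xk xl; apply: contrapT => x2.
  have Ui0 : (0 < U i)%N by rewrite Ui.
  have [r dr _] := ex_deficit Ux Ui0 xi x2.
  have sr : (size r <= 2)%N by case: dr => _ _ _ + _; lia.
  have c3 := @count3 _ r i k l (introN eqP ik) (introN eqP kl) (introN eqP il).
  (* Each of i, k, l restricts r, and r has at most two terms. *)
have step p q : deficit p [:: q] -> U q = 2%N -> x <> p -> x <> q ->
      (0 < count_mem p r)%N \/ count_mem q r = 2%N.
    move=> dp Uq xp xq; case: (conflict dp dr (nesym xp)).
    - by rewrite -has_pred1 has_count; left.
    - by rewrite inE => /eqP.
    move=> [y [_ _]] /=; case: dr => _ _ /(_ y) cy _ _.
    have [<-|_] := eqVneq q y; last by rewrite ltnNge cy.
    have cq := seq.count_size (pred1 q) r; rewrite Uq /= in cq *.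
    by right; lia.
  have := step i k dk Uk xi xk; have := step k l dl Ul xk xl.
  by have := step l i dm Ui xl xi; rewrite /= in c3 *; lia.
pose X := msetn 2 i `+` msetn 2 k `+` msetn 2 l.
pose E := U `\` X.
have le : X `<=` U.
  apply/msubsetP => x; rewrite !msetE2 !msetnE.
  have [->|_] := eqVneq x i.
    by move/eqP/negbTE: ik => ->; move/eqP/negbTE: il => ->; rewrite Ui.
  have [->|_] := eqVneq x k; first by move/eqP/negbTE: kl => ->; rewrite Uk.
  by have [->|_] := eqVneq x l; rewrite ?Ul.
have sE : (size E + 6)%N = D.
  by have := size_msetB le; rewrite sU !size_msetD !size_msetn.
have leE : E `<=` U := msubsetDl _ _.
have E2 x : (0 < E x)%N -> x + x = 0.
  rewrite /E !msetE2 !msetnE => Ex; apply: rest; first by lia.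
  - by move=> xe; move: Ex; rewrite xe eqxx Ui; lia.
  - by move=> xe; move: Ex; rewrite xe eqxx Uk; lia.
  - by move=> xe; move: Ex; rewrite xe eqxx Ul; lia.
apply: (@power_free 6 i E leE).
- by move=> eEU; move: sE; rewrite eEU sU; lia.
- by lia.
move=> c E' /andP[c0 c6] leE' z.
have x2 : msum E' + msum E' = 0.
  by apply: msum_double => x Ex; apply: E2; have := msubsetP leE' x; lia.
have icc : i *+ (c + c) = 0.
  have := congr1 (fun t => t + t) z; rewrite addr0 addrACA x2 addr0.
  by rewrite -mulrnDr.
have i1 := mulrn_gcd i28 icc.
have i4 : i *+ 4 = 0.
  apply: mulrn_dvd i1 _.
  by move: c c0 c6 {z icc} => [|[|[|[|[|[|[|c]]]]]]].
by apply: ik; apply/eqP; rewrite kE -addr_eq0 -mulrS i4.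
Qed.

Let sqfree x : (U x <= 1)%N.
Proof. by rewrite leqNgt; apply/negP => /U2P/no_repeated_term. Qed.

(** Two different deficits i, i, k, l and i, i, k', l' give the balanced pair
k + l = k' + l' of size four, so D = 6 and U has only one further term, which
is 3i. *)
Lemma sqfree_step i : (0 < U i)%N -> i + i <> 0 -> D = 6%N /\ (0 < U (i *+ 3))%N.
Proof.
move=> Ui i2; have U1 : U i = 1%N by have := sqfree i; lia.
have [j Uj ij] := ex_distinct i.
have [k [l [dkl _]]] := deficit1 U1 i2 Uj ij.
have [Uk ik] : (0 < U k)%N /\ i <> k by apply: (deficit_mem dkl); rewrite mem_head.
have [Ul il] : (0 < U l)%N /\ i <> l by apply: (deficit_mem dkl); rewrite !inE eqxx orbT.
have kl : k <> l.
  by move=> e; case: dkl => _ _ /(_ k) + _ _; by rewrite /= -e eqxx => /leq_trans/(_ (sqfree k)).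
have [k' [l' [dkl' lt]]] := deficit1 U1 i2 Uk ik.
have [Uk' ik'] : (0 < U k')%N /\ i <> k' by apply: (deficit_mem dkl'); rewrite mem_head.
have [Ul' il'] : (0 < U l')%N /\ i <> l' by apply: (deficit_mem dkl'); rewrite !inE eqxx orbT.
have kl' : k' <> l'.
  by move=> e; case: dkl' => _ _ /(_ k') + _ _; by rewrite /= -e eqxx => /leq_trans/(_ (sqfree k')).
have [kk' kl2] : k' <> k /\ l' <> k.
  by split=> e; move: lt; rewrite e eqxx; have := sqfree k; rewrite /=; lia.
have zr : i *+ 2 + (k + l) = 0.
  by case: dkl => _ _ _ _; rewrite U1 !big_cons big_nil addr0.
have zr' : i *+ 2 + (k' + l') = 0.
  by case: dkl' => _ _ _ _; rewrite U1 !big_cons big_nil addr0.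
have eS : k + l = k' + l' by apply: (addrI (i *+ 2)); rewrite zr zr'.
have lk' : l <> k'.
  by move=> e; apply: kl2; move: eS; rewrite -e addrC => /addrI.
have ll' : l <> l'.
  by move=> e; apply: kk'; move: eS; rewrite -e => /addIr.
have d : disjoint_supp [mset k; l] [mset k'; l'].
  move=> x; rewrite !mset2E.
  have [->|_] := eqVneq x k.
    by right; move/eqP/negbTE: kk'; rewrite eq_sym => ->; move/eqP/negbTE: kl2; rewrite eq_sym => ->.
  have [->|_] := eqVneq x l; last by left.
  by right; move/eqP/negbTE: lk' => ->; move/eqP/negbTE: ll' => ->.
have le1 : [mset k; l] `<=` U.
  by apply: mset2_sub; move/eqP/negbTE: kl => ->.
have le2 : [mset k'; l'] `<=` U.
  by apply: mset2_sub; move/eqP/negbTE: kl' => ->.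
have r : balanced U [mset k; l] [mset k'; l'].
  split=> //; first exact: disjoint_supp_sub; first by rewrite !msum2.
  by apply: (@neq0_count _ k); rewrite !msetE2 !mset1E eqxx.
have := balanced_sizes r; rewrite !size_mset2 => sD.
have eD : D = 6%N by lia.
split=> //.
pose X := [mset k; l] `+` [mset k'; l'] `+` [mset i].
have le : X `<=` U.
  apply/msubsetP => x; have := msubsetP (disjoint_supp_sub d le1 le2) x.
  rewrite !msetE2 !mset1E.
  have [->|_] := eqVneq x i; last by lia.
  move/eqP/negbTE: ik => ->; move/eqP/negbTE: il => ->.
  by move/eqP/negbTE: ik' => ->; move/eqP/negbTE: il' => ->.
have /size1_ex[m em] : size (U `\` X) = 1%N.
  by have := size_msetB le; rewrite /X !size_msetD !size_msetn sU eD; lia.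
have mU : (0 < U m)%N.
  by have := msubsetP (msubsetDl U X) m; rewrite em msetnxx.
suff <- : m = i *+ 3 by [].
have : msum (U `\` X) = m by rewrite em msum1.
rewrite msumB // sumU /X !msumD !msum1 sub0r => <-.
have kE : k + l = - (i *+ 2) by apply/eqP; rewrite -addr_eq0 addrC zr.
by rewrite -eS kE !opprD !opprK addrA addrK mulrS mulr2n addrA.
Qed.

(** With i also 3i is a term.  This leaves the orders 5 and 6 for i: order 5
would yield the term 9i = -i, and for order 6 all six terms of U would be among
the five nonzero multiples of i. *)
Lemma no_triple_case : False.
Proof.
have [i Ui i2] := ex_order_gt2 aU sU D3 HL a2 aD.
have [eD Um] := sqfree_step Ui i2.
have i0 := mem_neq0 aU sU D3 Ui.
have i3 : i *+ 3 <> 0 by apply: (mem_neq0 aU sU D3).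
have mi : i <> i *+ 3.
  move=> e; apply: i2; apply: (addrI i); rewrite addr0.
  by rewrite [RHS]e !mulrS mulr0n addr0.
have i4 : i *+ 4 <> 0.
  by rewrite mulrS; apply: (pairF2 aU sU D3).
have i5 : i *+ 5 <> 0.
  move=> i5; have m2 : i *+ 3 + i *+ 3 <> 0.
    by rewrite -mulrnDr (_ : (3 + 3 = 5 + 1)%N) // mulrnDr i5 add0r mulr1n.
  have [_] := sqfree_step Um m2.
  rewrite -mulrnA (_ : (3 * 3 = 5 + 4)%N) // mulrnDr i5 add0r => U4.
  have i14 : i <> i *+ 4.
    by rewrite mulrS => e; apply: i3; apply: (addrI i); rewrite -e addr0.
  by apply: (pairF2 aU sU D3 Ui U4 i14); rewrite -mulrS.
have i6 : i *+ 6 = 0.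
  apply: contrapT => i6.
  apply: (@power_free 6 i mset0 (msub0set _)).
  - by move=> U0; move: sU2; rewrite -U0 enum_mset0.
  - by rewrite enum_mset0 eD.
  move=> c E' /andP[c0 c6]; rewrite msubset0 => /eqP ->; rewrite msum0 addr0.
  by move: c c0 c6 => [|[|[|[|[|[|[|c]]]]]]] //; rewrite ?mulr1n ?mulr2n.
have low c : (0 < c <= 5)%N -> i *+ c <> 0.
  by move: c => [|[|[|[|[|[|c]]]]]] //; rewrite ?mulr1n ?mulr2n.
have mult x : (0 < U x)%N -> x \in [seq i *+ c | c <- iota 1 5].
  move=> Ux; apply: contrapT => nx.
  apply: (@power_free 5 i [mset x] (mset1_sub Ux)).
  - by move=> eU; move: sU2; rewrite -eU size_msetn.
  - by rewrite size_msetn eD.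
  move=> c E' /andP[c0 c5] leE'.
  have [E0|/eqP E0] := eqVneq E' mset0.
    by rewrite E0 msum0 addr0; apply: low; rewrite c0.
  have -> : E' = [mset x].
    by apply: sub_size_eq leE' _; rewrite size_msetn lt0n size_mset_eq0; apply/eqP.
  rewrite msum1 => z; apply: nx; apply/mapP; exists (6 - c)%N.
    by rewrite mem_iota; lia.
  by apply: (addrI (i *+ c)); rewrite z -mulrnDr subnKC // ltnW.
have : (size U <= size [seq i *+ c | c <- iota 1 5])%N.
  apply: uniq_leq_size; last by move=> x; rewrite -mset_gt0; apply: mult.
  by apply/count_mem_uniq => x; rewrite count_mem_mset -mset_gt0; have := sqfree x; case: (U x) => [|[|]].
by rewrite sU eD.
Qed.

End NoTriple.

Theorem shape_C2pow_C4 : exists e, [/\ e *+ 4 = 0, e + e <> 0 &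
  forall x, (0 < U x)%N -> [\/ x = e, x + x = 0 | (x + e) + (x + e) = 0]].
Proof.
have [[e Ue]|no3] := pselect (exists e, U e = 3%N); first exact: triple_case Ue.
by exfalso; apply: no_triple_case => x Ux; apply: no3; exists x.
Qed.

End Lengths24D.

(** * Upper bounds for Davenport constants *)

Section Davenport_bounds.

Lemma atom_enum (G : zmodType) (U : {mset G}) g s t : atom U ->
  enum_mset U = g :: s -> (forall x, (count_mem x t <= count_mem x s)%N) ->
  t <> [::] -> \sum_(x <- t) x <> 0.
Proof.
move=> /atomP[_ _ minU] eU le t0 zt.
have Ux x : U x = ((g == x) + count_mem x s)%N by rewrite -count_mem_mset eU.
have eT : seq_mset t = U.
  apply: minU.
  - by apply/msubsetP => x; rewrite mset_seqE Ux; have := le x; lia.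
  - by rewrite /msum (perm_big _ (perm_eq_seq_mset t)).
  - move=> T0; apply: t0; apply/nilP; rewrite /nilp.
    by rewrite -(perm_size (perm_eq_seq_mset t)) T0 enum_mset0.
have := congr1 (fun S : {mset G} => S g) eT.
by rewrite /= Ux mset_seqE eqxx; have := le g; rewrite /=; lia.
Qed.

Section Degree.
Variable G : zmodType.
Implicit Types (f g : G -> bool) (x h : G) (d : nat) (s t : seq G).

(** Functions of degree less than d for finite differences, with values in the
field of two elements. *)
Fixpoint deg_lt d f : Prop :=
  if d is d'.+1 then forall h, deg_lt d' (fun x => f x (+) f (x + h))
  else forall x, f x = false.

Lemma deg_lt_ext d f g : f =1 g -> deg_lt d f -> deg_lt d g.
Proof.
elim: d f g => [|d IH] f g fg /= df; first by move=> x; rewrite -fg.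
by move=> h; apply: IH (df h) => x; rewrite !fg.
Qed.

Lemma deg_lt_xor d f g : deg_lt d f -> deg_lt d g ->
  deg_lt d (fun x => f x (+) g x).
Proof.
elim: d f g => [|d IH] f g /= df dg; first by move=> x; rewrite df dg.
by move=> h; apply: deg_lt_ext (IH _ _ (df h) (dg h)) => x; rewrite addbACA.
Qed.

Lemma deg_lt0 d f : (forall x, f x = false) -> deg_lt d f.
Proof.
by elim: d f => [|d IH] f f0 //= h; apply: IH => x; rewrite !f0.
Qed.

Lemma deg_lt_le d1 d2 f : (d1 <= d2)%N -> deg_lt d1 f -> deg_lt d2 f.
Proof.
elim: d1 d2 f => [|d1 IH] [|d2] f //=; first by move=> _ f0 h; apply: deg_lt0 => x; rewrite !f0.
by move=> le df h; apply: IH (df h).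
Qed.

Lemma deg_lt_shift d f h : deg_lt d f -> deg_lt d (fun x => f (x + h)).
Proof.
elim: d f => [|d IH] f /= df; first by [].
move=> k; apply: deg_lt_ext (IH _ (df k)) => x.
by rewrite [x + h + k]addrAC.
Qed.

(** This is the product rule for differences. *)
Lemma deg_lt_and a b f g : deg_lt a.+1 f -> deg_lt b.+1 g ->
  deg_lt (a + b).+1 (fun x => f x && g x).
Proof.
have [n] := ubnP (a + b); elim: n a b f g => // n IH a b f g ltn df dg h.
pose f1 x := (f x (+) f (x + h)) && g x.
pose g1 x := f (x + h) && (g x (+) g (x + h)).
apply: (@deg_lt_ext _ (fun x => f1 x (+) g1 x)).
  by move=> x; rewrite /f1 /g1; case: (f x); case: (f (x + h)); case: (g x); case: (g (x + h)).
apply: deg_lt_xor.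
  case: a ltn df => [|a] ltn df.
    by apply: deg_lt0 => x; rewrite /f1 (df h x).
  by apply: (IH a b _ g); [lia | exact: (df h) | exact: dg].
case: b ltn dg => [|b] ltn dg.
  by apply: deg_lt0 => x; rewrite /g1 (dg h x) andbF.
change (deg_lt (a + b.+1)%N g1); rewrite addnS; apply: (IH a b (fun x => f (x + h)) _); first by lia.
  exact: deg_lt_shift.
exact: (dg h).
Qed.

(** The sum modulo two of f over all x plus a subsum of s, that is, an iterated
difference of f at x. *)
Fixpoint cube_sum s f x : bool :=
  if s is h :: s' then cube_sum s' f x (+) cube_sum s' f (x + h) else f x.

Lemma cube_sumD s f g x :
  cube_sum s (fun y => f y (+) g y) x = cube_sum s f x (+) cube_sum s g x.
Proof. by elim: s x => //= h s IH x; rewrite !IH addbACA. Qed.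

Lemma cube_sum_shift s f h x : cube_sum s (fun y => f (y + h)) x = cube_sum s f (x + h).
Proof. by elim: s x => //= k s IH x; rewrite !IH addrAC. Qed.

Lemma cube_sum_deg s f x : deg_lt (size s) f -> cube_sum s f x = false.
Proof.
elim: s f x => [|h s IH] f x /= df; first exact: df.
by rewrite -cube_sum_shift -cube_sumD; apply: IH.
Qed.

Lemma cube_sum_lone s f x :
  (forall t, subseq t s -> t <> [::] -> f (x + \sum_(y <- t) y) = false) ->
  cube_sum s f x = f x.
Proof.
elim: s x => //= h s IH x H; rewrite IH; last first.
  by move=> t ts; apply: H; apply: subseq_trans ts (subseq_cons _ _).
rewrite IH.
  have := H [:: h]; rewrite big_seq1 /= eqxx sub0seq => /(_ isT) ->//.
  by rewrite addbF.
move=> t ts t0; have := H (h :: t).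
by rewrite big_cons addrA /= eqxx; apply.
Qed.

(** If 0 is no nonempty subsum of s, then the iterated difference at 0 of the
indicator function of 0 has the empty subsum as its only nonzero term. *)
Lemma deg_lt_davenport d : deg_lt d (fun x => x == 0) -> davenport_le G d.
Proof.
move=> dd U aU; rewrite leqNgt; apply/negP => sU.
case eU : (enum_mset U) => [|g s]; first by move: sU; rewrite eU.
have ss : (d <= size s)%N by move: sU; rewrite eU.
have := cube_sum_deg 0 (deg_lt_le ss dd).
rewrite cube_sum_lone ?eqxx // => t ts t0; rewrite add0r; apply/eqP.
by apply: (atom_enum aU eU _ t0) => x; apply: leq_count_subseq.
Qed.

End Degree.

Lemma deg_lt_comp (G H : zmodType) (p : G -> H) d f :
  (forall x y, p (x + y) = p x + p y) -> deg_lt d f -> deg_lt d (f \o p).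
Proof.
move=> pD; elim: d f => [|d IH] f /= df; first by move=> x; apply: df.
move=> h; apply: deg_lt_ext (IH _ (df (p h))) => x /=.
by rewrite pD.
Qed.

Lemma deg_Z2 : deg_lt 2 (fun x : 'Z_2 => x == 0).
Proof. by move=> [[|[|]] // ?] [[|[|]] // ?] [[|[|]] // ?]. Qed.

Lemma deg_Z4 : deg_lt 4 (fun x : 'Z_4 => x == 0).
Proof.
by move=> [[|[|[|[|]]]] // ?] [[|[|[|[|]]]] // ?] [[|[|[|[|]]]] // ?]
  [[|[|[|[|]]]] // ?] [[|[|[|[|]]]] // ?].
Qed.

(** The indicator function of 0 is the product of r - 1 functions of degree one,
from the coordinates in C_2, and of one function of degree three from C_4. *)
Lemma davenport_le_C2pow_C4 r : (0 < r)%N -> davenport_le (C2pow_C4 r) (r + 3).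
Proof.
move=> r0; apply: deg_lt_davenport.
pose allz (s : seq 'I_(r - 1)) (x : C2pow_C4 r) := all (fun i => x.1 i == 0) s.
have dall s : deg_lt (size s).+1 (allz s).
  elim: s => [|i s IH] /=; first by move=> h x.
  have di : deg_lt 2 (fun x : C2pow_C4 r => x.1 i == 0).
    by apply: (deg_lt_comp (p := fun x : C2pow_C4 r => x.1 i)) deg_Z2 => x y; rewrite ffunE.
  exact: (deg_lt_and (a := 1) (b := size s) di IH).
have d4 : deg_lt 4 (fun x : C2pow_C4 r => x.2 == 0).
  by apply: (deg_lt_comp (p := fun x : C2pow_C4 r => x.2)) deg_Z4.
have := deg_lt_and (dall (enum 'I_(r - 1))) d4.
rewrite size_enum_ord (_ : (r - 1 + 3).+1 = r + 3)%N; last by lia.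
apply: deg_lt_ext => -[x1 x2] /=; rewrite /allz /= xpair_eqE; congr (_ && _).
apply/allP/eqP => [x0|-> i _]; last by rewrite ffunE.
by apply/ffunP => i; rewrite ffunE; apply/eqP/x0; rewrite mem_enum.
Qed.

Lemma odd_Zp p (a b : 'Z_p) : (1 < p)%N -> ~~ odd p ->
  odd (a + b)%R = odd a (+) odd b.
Proof.
move=> p1 op; rewrite -oddD.
have e : (a + b : 'Z_p) = ((a + b) %% p)%N :> nat.
  by rewrite /=; congr (_ %% _)%N; apply: Zp_cast.
by apply: (etrans (congr1 odd e)); rewrite odd_mod //; apply: negbTE.
Qed.

Section Blocks.
Variable n : nat.
Hypothesis n0 : (0 < n)%N.
Notation G := (C2_C2n n).
Implicit Types (x y z : G) (s t : seq G).

Definition parity x : bool * bool := (odd x.1, odd x.2).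

Let Zn : (Zp_trunc (2 * n)).+2 = (2 * n)%N.
Proof. by rewrite Zp_cast //; lia. Qed.

Lemma parityD x y :
  parity (x + y) = (odd x.1 (+) odd y.1, odd x.2 (+) odd y.2).
Proof.
by rewrite /parity !odd_Zp // ?oddM //; lia.
Qed.

(** The elements with trivial parity form the subgroup of the doubles, of order n. *)
Definition even_elt x := parity x == (false, false).

Lemma even_eltD x y : parity x = parity y -> even_elt (x + y).
Proof. by rewrite /even_elt parityD => -[-> ->]; rewrite !addbb. Qed.

Lemma even_elt_add x y : even_elt x -> even_elt y -> even_elt (x + y).
Proof. by move=> /eqP xe /eqP ye; apply: even_eltD; rewrite xe ye. Qed.

Lemma even_elt_sum (I : Type) (r : seq I) (F : I -> G) :
  all (fun i => even_elt (F i)) r -> even_elt (\sum_(i <- r) F i).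
Proof.
elim: r => [|i r IH]; first by rewrite big_nil.
by move=> /andP[ei er]; rewrite big_cons; apply: even_elt_add (IH er).
Qed.

Lemma pick_pair s : ~~ uniq (map parity s) ->
  exists x y r, perm_eq s [:: x, y & r] /\ parity x = parity y.
Proof.
elim: s => //= x s IH; rewrite negb_and negbK => /orP[/mapP[y ys exy]|/IH].
  by exists x, y, (rem y s); split=> //; rewrite perm_cons perm_to_rem.
move=> [y [z [r [p e]]]]; exists y, z, (x :: r); split=> //.
apply: (perm_trans (y := [:: x, y, z & r])); first by rewrite perm_cons.
by apply/permP => q /=; lia.
Qed.

Lemma pick_three x y z : exists t u,
  [/\ perm_eq [:: x; y; z] (t ++ u), t <> [::] & even_elt (\sum_(w <- t) w)].
Proof.
have [ex|ex] := boolP (even_elt x).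
  by exists [:: x], [:: y; z]; rewrite big_seq1.
have [ey|ey] := boolP (even_elt y).
  exists [:: y], [:: x; z]; rewrite big_seq1; split=> //.
  by apply/permP => q /=; lia.
have [ez|ez] := boolP (even_elt z).
  exists [:: z], [:: x; y]; rewrite big_seq1; split=> //.
  by apply/permP => q /=; lia.
have [exy|exy] := eqVneq (parity x) (parity y).
  exists [:: x; y], [:: z]; rewrite !big_cons big_nil addr0; split=> //.
  exact: even_eltD.
have [exz|exz] := eqVneq (parity x) (parity z).
  exists [:: x; z], [:: y]; rewrite !big_cons big_nil addr0; split=> //.
    by apply/permP => q /=; lia.
  exact: even_eltD.
have [eyz|eyz] := eqVneq (parity y) (parity z).
  exists [:: y; z], [:: x]; rewrite !big_cons big_nil addr0; split=> //.
    by apply/permP => q /=; lia.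
  exact: even_eltD.
exists [:: x; y; z], [::]; split=> //; rewrite !big_cons big_nil addr0.
apply: even_eltD; rewrite parityD; move: ex ey ez exy exz eyz.
rewrite /even_elt /parity; move: (odd x.1) (odd x.2) (odd y.1) (odd y.2) (odd z.1) (odd z.2).
by do 6 case.
Qed.

(** Among five elements two have the same parity and form a block; the last block
is found among three elements. *)
Lemma blocks k s : (0 < k)%N -> (2 * k + 1 <= size s)%N ->
  exists (bs : seq (seq G)) u, [/\ size bs = k, all (fun b => b != [::]) bs,
    all (fun b => even_elt (\sum_(w <- b) w)) bs & perm_eq s (flatten bs ++ u)].
Proof.
case: k => // k _; elim: k s => [|k IH] s.
  case: s => [|x [|y [|z s]]] // _; have [t [u [p /eqP t0 et]]] := pick_three x y z.
  exists [:: t], (u ++ s); split; rewrite /= ?t0 ?et ?cats0 // catA.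
  by rewrite -[[:: x, y, z & s]]/([:: x; y; z] ++ s) perm_cat2r.
move=> ss; have : ~~ uniq (map parity s).
  apply/negP => /card_uniqP; have := max_card [in map parity s].
  by rewrite card_prod card_bool size_map => + e; rewrite e; lia.
move=> /pick_pair[x [y [r [p exy]]]].
have [|bs [u [sb b0 be pb]]] := IH r.
  by move: ss; rewrite (perm_size p) /=; lia.
exists ([:: x; y] :: bs), u; split=> //=; first by rewrite sb.
  by rewrite !big_cons big_nil addr0 even_eltD.
by apply: (perm_trans p); rewrite !perm_cons.
Qed.

Lemma even_half x y : even_elt x -> even_elt y -> (x.2)./2 = (y.2)./2 -> x = y.
Proof.
case: x y => [x1 x2] [y1 y2] /eqP[] /= ox1 ox2 /eqP[] /= oy1 oy2 e.
congr (_, _); apply: val_inj => /=; last first.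
  by rewrite -[LHS]odd_double_half -[RHS]odd_double_half ox2 oy2 e.
by move: x1 y1 ox1 oy1 {e} => [[|[|]] //= ?] [[|[|]] //= ?].
Qed.

(** Two of the n + 1 partial sums of the block sums agree. *)
Lemma zero_block (bs : seq (seq G)) : all (fun b => even_elt (\sum_(w <- b) w)) bs ->
  (n <= size bs)%N -> exists i j, [/\ (i < j)%N, (j <= size bs)%N &
    \sum_(w <- flatten (take (j - i) (drop i bs))) w = 0].
Proof.
move=> be sb.
pose P j : G := \sum_(b <- take j bs) \sum_(w <- b) w.
have Pe j : even_elt (P j).
  apply: even_elt_sum; apply/allP => b /mem_take; apply: (allP be).
have : ~~ uniq [seq ((P j).2 : 'Z_(2 * n))./2 | j <- iota 0 n.+1].
  apply/negP => us; have := uniq_leq_size (s2 := iota 0 n) us.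
  rewrite size_map !size_iota ltnn => /(_ _)/negP; apply; rewrite ?negbK //.
  move=> _ /mapP[j _ ->]; rewrite mem_iota /= add0n ltn_half_double -mul2n.
  by apply: leq_trans (ltn_ord _) _; rewrite Zn.
move/(uniqPn 0%N) => [i [j [ij]]]; rewrite size_map size_iota => jn.
rewrite !(nth_map 0%N) ?size_iota ?nth_iota ?add0n //; try lia.
move/(even_half (Pe i) (Pe j)) => eP.
exists i, j; split; [by [] | by lia |].
rewrite big_flatten /=; move: eP; rewrite /P -[in take j bs](subnKC (ltnW ij)) takeD big_cat /=.
by rewrite -{1}[X in X = _]addr0 => /addrI.
Qed.

Lemma davenport_le_C2_C2n : davenport_le G (2 * n + 1).
Proof.
move=> U aU; rewrite leqNgt; apply/negP => sU.
case eU : (enum_mset U) => [|g s]; first by move: sU; rewrite eU.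
have ss : (2 * n + 1 <= size s)%N by move: sU; rewrite eU.
have [bs [u [sb b0 be pb]]] := blocks n0 ss.
have [|i [j [ij jb z]]] := zero_block be; first by rewrite sb.
apply: (atom_enum aU eU _ _ z).
  move=> x; rewrite (permP pb) count_cat; apply: leq_trans (leq_addr _ _).
  rewrite -[X in (_ <= count _ (flatten X))%N](cat_take_drop i bs) flatten_cat count_cat.
  apply: leq_trans (leq_addl _ _).
  rewrite -[X in (_ <= count _ (flatten X))%N](cat_take_drop (j - i) (drop i bs)).
  by rewrite flatten_cat count_cat leq_addr.
have : (0 < size (drop i bs))%N by rewrite size_drop; lia.
have : (0 < j - i)%N by lia.
case: (j - i)%N => // m _.
have : all (fun b => b != [::]) (drop i bs).
  by apply/allP => b /mem_drop; apply: (allP b0).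
by case: (drop i bs) => //= -[|w b].
Qed.

End Blocks.
End Davenport_bounds.

(** * Extremal products in the two families of groups *)

Section Support.
Variable G : zmodType.
Implicit Types (A B U : {mset G}) (s : seq G).

Lemma mset_support s A : uniq s -> (forall x, x \notin s -> A x = 0%N) ->
  A = \big[msetD/mset0]_(x <- s) msetn (A x) x.
Proof.
move=> us A0; apply/msetP => y.
have -> : (\big[msetD/mset0]_(x <- s) msetn (A x) x) y =
    (\sum_(x <- s) msetn (A x) x y)%N.
  by elim: s {us A0} => [|x s IH]; rewrite ?big_nil ?mset0E // !big_cons msetE2 IH.
have [ys|ys] := boolP (y \in s); last first.
  rewrite A0 // big1_seq // => x /andP[_ xs]; rewrite msetnE.
  by case: eqP => // e; move: ys; rewrite e xs.
rewrite (big_rem y) //= msetnxx big1_seq ?addn0 // => x /andP[_].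
rewrite mem_rem_uniq // => /andP[xy _]; rewrite msetnE.
by rewrite eq_sym (negbTE xy).
Qed.

Lemma msum_support s A : uniq s -> (forall x, x \notin s -> A x = 0%N) ->
  msum A = \sum_(x <- s) x *+ A x.
Proof.
move=> us A0; rewrite {1}(mset_support us A0) {us A0}.
by elim: s => [|x s IH]; rewrite ?big_nil ?msum0 // !big_cons msumD msum_msetn IH.
Qed.

Lemma size_support s A : uniq s -> (forall x, x \notin s -> A x = 0%N) ->
  size A = (\sum_(x <- s) A x)%N.
Proof.
move=> us A0; rewrite {1}(mset_support us A0) {us A0}.
elim: s => [|x s IH]; first by rewrite !big_nil enum_mset0.
by rewrite !big_cons size_msetD size_msetn IH.
Qed.

(** In the explicit examples a single computation of all balanced pairs shows that
U is an atom and provides a marker. *)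
Lemma lengths_criterion U f l : msum U = 0 -> U f = 1%N -> (2 < size U)%N ->
  (forall A B, balanced U A B -> (A f + B f)%N = 1%N /\
     (A `+` B = U \/ [/\ (size A + size B)%N = l, A <> mset0 & B <> mset0])) ->
  (exists A B, balanced U A B /\ A `+` B <> U) ->
  atom U /\ forall k, is_length (U `+` mopp U) k <->
    [\/ k = 2%N, k = size U | (k + l)%N = (size U).+2].
Proof.
move=> zU Uf sU Hrel [A0 [B0 [rAB0 nf]]].
have aU : atom U.
  apply/atomP; split=> //; first by apply: (@neq0_count _ f); rewrite Uf.
  move=> T le zT T0; have r : balanced U T mset0.
    split; rewrite ?msetD0 ?msum0 // => x; right; exact: mset0E.
  by case: (Hrel T mset0 r) => _ [|[]//]; rewrite msetD0.
have sU1 : (1 < size U)%N by lia.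
split=> // k; split.
  apply: (lengths_by_marker aU sU Uf) => A B /Hrel[ABf [full|[s _ _]]]; first by left.
  by right.
case=> [->|->|e].
- exact/atom_length2/atom_opp.
- by apply: is_length_pairs; apply: atom_count0.
have [A [B [leA leB rAB aAB]]] := balanced_atom rAB0.
have lt : A `+` B <> U.
  move=> eU; apply: nf; have [le _ _ _] := rAB0.
  apply/eqP; rewrite eqEmsubset le -{1}eU; exact: msetDSS.
have := balanced_length aU sU1 rAB aAB.
have [_ [//|[-> _ _]]] := Hrel A B rAB.
by have -> : (2 + (size U - l) = k)%N; last by []; have := balanced_size_ge3 aU sU rAB; have [le _ _ _] := rAB; have := size_sub le; rewrite size_msetD; have [_ [//|[-> _ _]]] := Hrel A B rAB; lia.
Qed.

End Support.

(** The bound m itself is allowed, so that the two ends have to be identified. *)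
Lemma eq_mod_small a b m : (a <= m)%N -> (b <= m)%N -> a = b %[mod m] ->
  a = b \/ a = 0%N /\ b = m \/ a = m /\ b = 0%N.
Proof.
have [->|m0] := posnP m; first by rewrite !leqn0 => /eqP -> /eqP ->; left.
rewrite leq_eqVlt => /orP[/eqP ->|la]; rewrite leq_eqVlt => /orP[/eqP ->|lb].
- by left.
- by rewrite modnn modn_small // => <-; right; right.
- by rewrite modnn modn_small // => ->; right; left.
by rewrite !modn_small // => ->; left.
Qed.

Lemma Zp_nat_eq p a b : (1 < p)%N -> (a%:R = b%:R :> 'Z_p) -> a = b %[mod p].
Proof. by move=> p1 /(congr1 val); rewrite /= !val_Zp_nat. Qed.

Lemma pair_mulrn (G H : zmodType) (x : G * H) n : x *+ n = (x.1 *+ n, x.2 *+ n).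
Proof. by elim: n => [|n IH]; rewrite ?mulr0n // !mulrS IH. Qed.

Lemma odd_eq_mod a b : a = b %[mod 2] -> odd a = odd b.
Proof. by rewrite !modn2; case: (odd a); case: (odd b). Qed.

Lemma arith_C2_C2n n ae af ah be bf bh : (2 <= n)%N ->
  (ae + be <= (2 * n).-1)%N -> (af + bf <= 1)%N -> (ah + bh <= 1)%N ->
  odd (af + ah) = odd (bf + bh) -> ae + ah = be + bh %[mod 2 * n] ->
  ae = 0%N \/ be = 0%N ->
  (ae + be + (af + bf) + (ah + bh) = 0)%N \/
  [/\ (af + bf = 1)%N, (ah + bh = 1)%N & (ae + be = (2 * n).-1)%N \/
    [/\ (ae + be = 1)%N, (0 < ae + af + ah)%N & (0 < be + bf + bh)%N]].
Proof.
move=> n2 le_e le_f le_h o m d.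
have := @eq_mod_small (ae + ah) (be + bh) (2 * n) ltac:(lia) ltac:(lia) m.
have [f0|f1] : (af = 0 /\ bf = 0 \/ af + bf = 1)%N by lia.
  case: f0 => f0 f0'; rewrite f0 f0' in o *.
  have : (ah = 0 /\ bh = 0 \/ ah = 1 /\ bh = 0 \/ ah = 0 /\ bh = 1)%N by lia.
  by case=> [|[|]] [h0 h0']; rewrite h0 h0' in o *; move=> e; left; lia.
have : (ah = 0 /\ bh = 0 \/ ah = 1 /\ bh = 0 \/ ah = 0 /\ bh = 1)%N by lia.
have f1' : (af = 1 /\ bf = 0 \/ af = 0 /\ bf = 1)%N by lia.
case=> [[h0 h0']|h1].
  by case: f1' => -[f2 f2']; rewrite f2 f2' h0 h0' in o *.
move=> e {m o}; right; split; [by [] | by lia |].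
have [eq|eq] : (ae + be = (2 * n).-1 \/ ae + be = 1)%N by lia.
  by left.
by right; split; lia.
Qed.

Lemma arith_C4 ae af be bf : (ae + be <= 3)%N -> (af + bf <= 1)%N ->
  ae + af = be + bf %[mod 4] -> ae = 0%N \/ be = 0%N ->
  (ae + be = 0 /\ af + bf = 0)%N \/
  (af + bf = 1)%N /\ ((ae + be = 3)%N \/
    [/\ (ae + be = 1)%N, (0 < ae + af)%N & (0 < be + bf)%N]).
Proof.
move=> le_e le_f m d.
have e := @eq_mod_small (ae + af) (be + bf) 4 ltac:(lia) ltac:(lia) m; clear m.
have [f0|f1] : (af + bf = 0 \/ af + bf = 1)%N by lia.
  by left; lia.
right; split=> //.
have [eq|eq] : (ae + be = 3 \/ ae + be = 1)%N by lia.
  by left.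
by right; split; lia.
Qed.

Section ExampleC2C2n.
Variable n : nat.
Hypothesis n2 : (2 <= n)%N.
Notation G := (C2_C2n n).
Let p1 : (1 < 2 * n)%N. Proof. lia. Qed.
Let e : G := (0, 1).
Let f : G := (1, 0).
Let h : G := (1, 1).
Let U : {mset G} := [mset f; h] `+` msetn (2 * n).-1 e.

Let one_neq0 : (1 : 'Z_(2 * n)) == 0 = false.
Proof. exact: oner_eq0. Qed.
Let ef : (e == f) = false. Proof. by rewrite xpair_eqE. Qed.
Let eh : (e == h) = false. Proof. by rewrite xpair_eqE. Qed.
Let fh : (f == h) = false.
Proof. by rewrite xpair_eqE eqxx eq_sym one_neq0. Qed.
Let us : uniq [:: e; f; h].
Proof. by []. Qed.
Let Ue : U e = (2 * n).-1.
Proof. by rewrite !msetE2 !mset1E ef eh msetnxx. Qed.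
Let Uf : U f = 1%N.
Proof. by rewrite !msetE2 !mset1E eqxx fh msetnE eq_sym ef. Qed.
Let Uh : U h = 1%N.
Proof. by rewrite !msetE2 !mset1E eqxx eq_sym fh msetnE eq_sym eh. Qed.
Let U0 x : x \notin [:: e; f; h] -> U x = 0%N.
Proof.
rewrite !inE !negb_or => /and3P[/negbTE xe /negbTE xf /negbTE xh].
by rewrite !msetE2 !mset1E msetnE xe xf xh.
Qed.
Let A0 A : A `<=` U -> forall x, x \notin [:: e; f; h] -> A x = 0%N.
Proof. by move=> le x /U0 Ux; have := msubsetP le x; rewrite Ux leqn0 => /eqP. Qed.

Let sumA A : A `<=` U -> msum A = ((A f + A h)%:R, (A e + A h)%:R).
Proof.
move=> le; rewrite (msum_support us (A0 le)) !big_cons big_nil !pair_mulrn /=.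
by rewrite !mul0rn addr0 !natrD; congr (_, _) => /=; rewrite ?add0r ?addr0.
Qed.
Let sizeA A : A `<=` U -> size A = (A e + A f + A h)%N.
Proof. by move=> le; rewrite (size_support us (A0 le)) !big_cons big_nil addn0 addnA. Qed.

Let sU : size U = (2 * n + 1)%N.
Proof. by rewrite /U size_msetD size_mset2 size_msetn; lia. Qed.

Let balancedU A B : balanced U A B -> (A f + B f)%N = 1%N /\
  (A `+` B = U \/ [/\ (size A + size B)%N = 3%N, A <> mset0 & B <> mset0]).
Proof.
move=> [le dAB eAB AB0].
have leA : A `<=` U.
  by apply: msubset_trans le; apply/msubsetP => x; rewrite msetE2 leq_addr.
have leB : B `<=` U.
  by apply: msubset_trans le; apply/msubsetP => x; rewrite msetE2 leq_addl.
move: eAB; rewrite !sumA // => -[/(Zp_nat_eq (isT : 1 < 2)%N)/odd_eq_mod].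
move=> o1 /(Zp_nat_eq p1) m2.
have le_ x : (A x + B x <= U x)%N by have := msubsetP le x; rewrite msetE2.
have le_e := le_ e; have le_f := le_ f; have le_h := le_ h.
rewrite Ue in le_e; rewrite Uf in le_f; rewrite Uh in le_h.
have ext (C D : {mset G}) : (forall x, x \in [:: e; f; h] -> (C x = D x)) -> C `<=` U -> D `<=` U -> C = D.
  move=> H leC leD; apply/msetP => x; have [/H//|nx] := boolP (x \in [:: e; f; h]).
  by rewrite (A0 leC nx) (A0 leD nx).
case: (arith_C2_C2n n2 le_e le_f le_h o1 m2 (dAB e)) => [s0|[f1 h1 e1]].
  exfalso; apply: AB0; apply/eqP; rewrite -size_mset_eq0 size_msetD !sizeA //.
  by apply/eqP; rewrite addnACA (addnACA (A e)).
split=> //; case: e1 => [e1|[e1 pA pB]]; [left | right].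
  apply: ext => //; last exact: msubset_refl.
  by move=> x; rewrite !inE => /or3P[] /eqP ->; rewrite msetE2 ?Ue ?Uf ?Uh.
split.
- by rewrite !sizeA // addnACA (addnACA (A e)) e1 f1 h1.
- by move=> eA; move: pA; rewrite eA !mset0E.
- by move=> eB; move: pB; rewrite eB !mset0E.
Qed.

Lemma C2_C2n_set : exists2 S : {mset G}, zero_sum S &
  forall k, is_length S k <-> [\/ k = 2%N, k = (2 * n)%N | k = (2 * n + 1)%N].
Proof.
exists (U `+` mopp U).
  by rewrite /zero_sum -/(msum _) msumD msum_opp subrr.
have zU : msum U = 0.
  rewrite sumA ?msubset_refl // Uf Uh Ue [(_.-1 + 1)%N]addn1 prednK; last by lia.
  by congr (_, _); apply: val_inj; rewrite /= ?val_Zp_nat // modnn.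
have sU2 : (2 < size U)%N by rewrite sU; lia.
have r : balanced U [mset f; h] [mset e].
  have le1 : [mset f; h] `<=` U by apply: mset2_sub; rewrite fh ?Uf ?Uh.
  have le2 : [mset e] `<=` U by apply: mset1_sub; rewrite Ue; lia.
  have d : disjoint_supp [mset f; h] [mset e].
    move=> x; rewrite mset2E mset1E; have [->|_] := eqVneq x e; last by right.
    by left; rewrite ef eh.
  split; [exact: disjoint_supp_sub | exact: d | | ].
    rewrite msum2 msum1; congr (_, _); rewrite /= ?add0r //; exact: val_inj.
  by apply: (@neq0_count _ e); rewrite msetE2 mset1E eqxx addn1.
have nf : [mset f; h] `+` [mset e] <> U.
  by move=> eU; have := sU; rewrite -eU size_msetD size_mset2 size_msetn; lia.
have [|aU HL] := @lengths_criterion G U f 3 zU Uf sU2 balancedU.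
  by exists [mset f; h], [mset e].
move=> k; rewrite HL sU; split.
  by case=> [->|->|eq]; [constructor 1 | constructor 3 | constructor 2; lia].
by case=> [->|->|->]; [constructor 1 | constructor 3; lia | constructor 2].
Qed.

End ExampleC2C2n.

Section ExampleC2powC4.
Variable r : nat.
Hypothesis r2 : (2 <= r)%N.
Notation G := (C2pow_C4 r).
Notation I := 'I_(r - 1).
Let e : G := (0, 1).
Let f : G := ([ffun=> 1], 1).
Let ee (i : I) : G := ([ffun j => (j == i)%:R], 0).
Let es := [seq ee i | i <- enum I].
Let U : {mset G} := [mset f] `+` msetn 3 e `+` seq_mset es.
Let i0 : I. Proof. by exists 0%N; lia. Qed.

Let ee_inj : injective ee.
Proof.
move=> i j [] /ffunP/(_ i); rewrite !ffunE eqxx.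
by case: eqVneq => // _ /eqP; rewrite oner_eq0.
Qed.
Let ef : (e == f) = false.
Proof.
apply/negbTE/eqP => -[] /ffunP/(_ i0); rewrite !ffunE => /eqP.
by rewrite eq_sym oner_eq0.
Qed.
Let ne_es x : x.2 = 1 -> x \notin es.
Proof. by move=> x2; apply/mapP => -[i _ ex]; move: x2; rewrite ex. Qed.
Let es_uniq : uniq es.
Proof. by rewrite map_inj_uniq // enum_uniq. Qed.
Let us : uniq [:: e, f & es].
Proof. by rewrite /= !inE ef /= !ne_es // es_uniq. Qed.
Let cnt x : x \notin es -> count_mem x es = 0%N.
Proof. by move/count_memPn. Qed.
Let Ue : U e = 3%N.
Proof. by rewrite !msetE2 !mset1E ef msetnxx mset_seqE cnt // ne_es. Qed.
Let Uf : U f = 1%N.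
Proof. by rewrite !msetE2 !mset1E eqxx msetnE eq_sym ef mset_seqE cnt // ne_es. Qed.
Let ee_f i : (ee i == f) = false.
Proof. by apply/negbTE/eqP => -[] _ /eqP; rewrite eq_sym oner_eq0. Qed.
Let ee_e i : (ee i == e) = false.
Proof. by apply/negbTE/eqP => -[] _ /eqP; rewrite eq_sym oner_eq0. Qed.
Let Ui i : U (ee i) = 1%N.
Proof.
rewrite !msetE2 !mset1E msetnE mset_seqE ee_f ee_e (count_uniq_mem _ es_uniq).
by rewrite map_f // mem_enum.
Qed.
Let U0 x : x \notin [:: e, f & es] -> U x = 0%N.
Proof.
rewrite !inE !negb_or => /and3P[/negbTE xe /negbTE xf xs].
by rewrite !msetE2 !mset1E msetnE xe xf mset_seqE cnt.
Qed.
Let A0 A : A `<=` U -> forall x, x \notin [:: e, f & es] -> A x = 0%N.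
Proof. by move=> le x /U0 Ux; have := msubsetP le x; rewrite Ux leqn0 => /eqP. Qed.

Let sumA2 A : A `<=` U -> (msum A).2 = (A e + A f)%:R.
Proof.
move=> le; rewrite (msum_support us (A0 le)) !big_cons big_map !pair_mulrn /=.
rewrite addrA natrD raddf_sum big1 ?addr0 // => i _.
by rewrite pair_mulrn /= mul0rn.
Qed.
Let sumA1 A i : A `<=` U -> (msum A).1 i = (A f + A (ee i))%:R.
Proof.
move=> le; rewrite (msum_support us (A0 le)) !big_cons big_map !pair_mulrn /=.
rewrite raddf_sum /= !ffunE ffunMnE !ffunE mul0rn add0r natrD; congr (_ + _).
  by rewrite ffunMnE ffunE.
rewrite sum_ffunE big_enum /= (bigD1 i) //= big1 ?addr0.
  by rewrite pair_mulrn /= ffunMnE ffunE eqxx.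
move=> j ji; rewrite pair_mulrn /= ffunMnE ffunE.
by rewrite eq_sym (negbTE ji) mul0rn.
Qed.
Let sizeA A : A `<=` U -> size A = (A e + A f + \sum_(i < r - 1) A (ee i))%N.
Proof.
move=> le; rewrite (size_support us (A0 le)) !big_cons big_map addnA.
by rewrite big_enum.
Qed.
Let sU : size U = (r + 3)%N.
Proof.
rewrite sizeA ?msubset_refl // Ue Uf (eq_bigr (fun=> 1%N)) // sum1_card card_ord.
lia.
Qed.

Let balancedU A B : balanced U A B -> (A f + B f)%N = 1%N /\
  (A `+` B = U \/ [/\ (size A + size B)%N = (r + 1)%N, A <> mset0 & B <> mset0]).
Proof.
move=> [le dAB eAB AB0].
have leA : A `<=` U.
  by apply: msubset_trans le; apply/msubsetP => x; rewrite msetE2 leq_addr.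
have leB : B `<=` U.
  by apply: msubset_trans le; apply/msubsetP => x; rewrite msetE2 leq_addl.
have m4 : A e + A f = B e + B f %[mod 4].
  by apply: (@Zp_nat_eq 4) => //; rewrite -!sumA2 // eAB.
have o2 i : odd (A f + A (ee i)) = odd (B f + B (ee i)).
  by apply/odd_eq_mod/(@Zp_nat_eq 2) => //; rewrite -!sumA1 // eAB.
have le_ x : (A x + B x <= U x)%N by have := msubsetP le x; rewrite msetE2.
have le_e := le_ e; have le_f := le_ f.
rewrite Ue in le_e; rewrite Uf in le_f.
have le_i i : (A (ee i) + B (ee i) <= 1)%N by rewrite -(Ui i).
have ext (C D : {mset G}) : (forall x, x \in [:: e, f & es] -> (C x = D x)) -> C `<=` U -> D `<=` U -> C = D.
  move=> H leC leD; apply/msetP => x; have [/H//|nx] := boolP (x \in [:: e, f & es]).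
  by rewrite (A0 leC nx) (A0 leD nx).
have par a b c d : odd (a + b) = odd (c + d) -> (a + c <= 1)%N -> (b + d <= 1)%N ->
    (a + c = b + d)%N.
  by case: a => [|[|a]]; case: b => [|[|b]]; case: c => [|[|c]]; case: d => [|[|d]].
have i_f i : (A (ee i) + B (ee i) = A f + B f)%N by rewrite (par _ _ _ _ (o2 i)).
case: (arith_C4 le_e le_f m4 (dAB e)) => [[e0 f0]|[f1 e1]].
  exfalso; apply: AB0; apply: ext => //; last exact: msub0set.
  move=> x; rewrite !inE mset0E => /or3P[/eqP->|/eqP->|/mapP[i _ ->]]; rewrite msetE2 //.
  by rewrite i_f.
split=> //; case: e1 => [e1|[e1 pA pB]]; [left | right].
  apply: ext => //; last exact: msubset_refl.
  move=> x; rewrite !inE => /or3P[/eqP->|/eqP->|/mapP[i _ ->]]; rewrite msetE2.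
  - by rewrite Ue.
  - by rewrite Uf.
  by rewrite Ui i_f.
split.
- rewrite !sizeA // addnACA -big_split /= (eq_bigr (fun=> 1%N)); last first.
    by move=> i _; rewrite i_f.
  by rewrite sum1_card card_ord addnACA e1 f1; lia.
- by move=> eA; move: pA; rewrite eA !mset0E.
- by move=> eB; move: pB; rewrite eB !mset0E.
Qed.

Lemma C2pow_C4_atom : exists2 V : {mset G}, atom V /\ size V = (r + 3)%N &
  zero_sum (V `+` mopp V) /\
  forall k, is_length (V `+` mopp V) k <-> [\/ k = 2%N, k = 4%N | k = (r + 3)%N].
Proof.
have leU := msubset_refl U.
have zU : msum U = 0.
  rewrite [msum U]surjective_pairing; congr (_, _).
    by apply/ffunP => i; rewrite sumA1 // Uf Ui ffunE; apply: val_inj.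
  by rewrite sumA2 // Ue Uf; apply: val_inj.
have sU2 : (2 < size U)%N by rewrite sU; lia.
pose A : {mset G} := [mset f] `+` seq_mset es.
have leA : A `<=` U.
  by apply/msubsetP => x; rewrite !msetE2; lia.
have leB : [mset e] `<=` U by apply: mset1_sub; rewrite Ue.
have Af : A f = 1%N by rewrite msetE2 mset1E eqxx mset_seqE cnt // ne_es.
have Ae : A e = 0%N by rewrite msetE2 mset1E ef mset_seqE cnt // ne_es.
have Ai i : A (ee i) = 1%N.
  by rewrite msetE2 mset1E ee_f mset_seqE (count_uniq_mem _ es_uniq) map_f // mem_enum.
have rAB : balanced U A [mset e].
  have d : disjoint_supp A [mset e].
    by move=> x; rewrite mset1E; have [->|_] := eqVneq x e; [left | right].
  split=> //; first exact: disjoint_supp_sub.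
    rewrite msum1 [msum A]surjective_pairing; congr (_, _).
      by apply/ffunP => i; rewrite sumA1 // Af Ai ffunE; apply: val_inj.
    by rewrite sumA2 // Ae Af.
  by apply: (@neq0_count _ e); rewrite msetE2 mset1E eqxx addn1.
have nf : A `+` [mset e] <> U.
  by move/msetP/(_ e); rewrite msetE2 Ae mset1E eqxx Ue.
have [|aU HL] := @lengths_criterion G U f (r + 1) zU Uf sU2 balancedU.
  by exists A, [mset e].
exists U => //; split.
  by rewrite /zero_sum -/(msum _) msumD msum_opp subrr.
move=> k; rewrite HL sU; split.
  by case=> [->|->|eq]; [constructor 1 | constructor 3 | constructor 2; lia].
by case=> [->|->|->]; [constructor 1 | constructor 3; lia | constructor 2].
Qed.

End ExampleC2powC4.

(** * Recognizing the groups *)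

Section Iso.

Lemma zmod_isomorphic_of (G H : zmodType) (psi : H -> G) :
  (forall x y, psi (x + y) = psi x + psi y) -> injective psi ->
  (forall y, exists x, psi x = y) -> zmod_isomorphic G H.
Proof.
move=> psiD inj surj; have [phi phiK] := choice surj.
have Kphi : cancel psi phi by move=> x; apply: inj; rewrite phiK.
have psiB x y : psi (x - y) = psi x - psi y.
  by apply: (addIr (psi y)); rewrite -psiD !subrK.
have phiB : GRing.zmod_morphism phi.
  by move=> x y; apply: inj; rewrite psiB !phiK.
pose phiM := GRing.isZmodMorphism.Build G H phi phiB.
pose phiA : {additive G -> H} := HB.pack phi phiM.
by exists phiA, psi.
Qed.

Lemma mulrn_ZpD (G : zmodType) (x : G) p (a b : 'Z_p) : (1 < p)%N ->
  x *+ p = 0 -> x *+ (a + b)%R = x *+ a + x *+ b.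
Proof.
move=> p1 xp; rewrite -mulrnDr [in RHS](divn_eq (a + b) p) mulrnDr.
rewrite mulnC mulrnA xp mul0rn add0r; congr (_ *+ _).
by rewrite /=; congr (_ %% _)%N; apply: Zp_cast.
Qed.

Lemma mulrn_mod (G : zmodType) (x : G) p k : x *+ p = 0 -> x *+ (k %% p) = x *+ k.
Proof.
by move=> xp; rewrite [in RHS](divn_eq k p) mulrnDr mulnC mulrnA xp mul0rn add0r.
Qed.

Lemma val_Zp_lt p (a : 'Z_p) : (1 < p)%N -> (a < p)%N.
Proof. by move=> p1; apply: leq_trans (ltn_ord a) _; rewrite Zp_cast. Qed.

(** Combinations of f and of fewer than 2n copies of g are subsequences of U, so
they are zero only trivially; and U generates G. *)
Lemma isomorphic_C2_C2n (G : zmodType) n (U : {mset G}) (f g : G) : (2 <= n)%N ->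
  atom U -> davenport_le G (2 * n + 1) -> f + f = 0 -> g *+ (2 * n) = 0 ->
  U = [mset f; g + f] `+` msetn (2 * n).-1 g -> zmod_isomorphic G (C2_C2n n).
Proof.
move=> n2 aU dG f2 gn eU; have p1 : (1 < 2 * n)%N by lia.
have sU : size U = (2 * n + 1)%N by rewrite eU size_msetD size_mset2 size_msetn; lia.
have D3 : (3 <= 2 * n + 1)%N by lia.
have [_ _ minU] := proj1 (atomP U) aU.
pose psi (x : C2_C2n n) : G := f *+ x.1 + g *+ x.2.
have f2' : f *+ 2 = 0 by rewrite mulr2n.
have psiD x y : psi (x + y) = psi x + psi y.
  by rewrite /psi !mulrn_ZpD // addrACA.
have psi0 x : psi x = 0 -> x = 0.
  case: x => c k; rewrite /psi /= => z.
  have kn := val_Zp_lt k p1.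
  have c2 : (c < 2)%N := ltn_ord c.
  pose T : {mset G} := msetn c f `+` msetn k g.
  have leT : T `<=` U.
    apply/msubsetP => x; rewrite eU !msetE2 !mset1E !msetnE.
    by case: (x == f); case: (x == g); case: (x == g + f); lia.
  have [T0|/eqP T0] := eqVneq T mset0.
    have : size T = 0%N by rewrite T0 enum_mset0.
    rewrite size_msetD !size_msetn => s0.
    by congr (_, _); apply: val_inj; rewrite /=; lia.
  have := minU T leT _ T0; rewrite msumD !msum_msetn => /(_ z) eT.
  by have := sU; rewrite -eT size_msetD !size_msetn; lia.
apply: (zmod_isomorphic_of (psi := psi)) => //.
- move=> x y exy; apply/eqP; rewrite -subr_eq0; apply/eqP/psi0.
  by apply: (addIr (psi y)); rewrite -psiD subrK exy add0r.
move=> y; have Uf : (0 < U f)%N by rewrite eU !msetE2 !mset1E eqxx; lia.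
have [Y leY <-] := subsum dG aU sU D3 y Uf.
have psiE a b : exists x, psi x = f *+ a + g *+ b.
  exists (inZp a, inZp b); rewrite /psi /=.
  by congr (_ + _); [exact: (mulrn_mod a f2') | apply: mulrn_mod; rewrite Zp_cast].
have mem x : x \in Y -> exists z, psi z = x.
  move=> xY; have : (0 < U x)%N.
    by have := msubsetP leY x; rewrite msetB1E; move: xY; rewrite -mset_gt0; lia.
  rewrite eU !msetE2 !mset1E msetnE.
  have [-> _|_] := eqVneq x f; first by have [z ez] := psiE 1%N 0%N; exists z; rewrite ez mulr0n addr0.
  have [-> _|_] := eqVneq x (g + f).
    by have [z ez] := psiE 1%N 1%N; exists z; rewrite ez addrC.
  by have [-> _|//] := eqVneq x g; have [z ez] := psiE 0%N 1%N; exists z; rewrite ez mulr0n add0r.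
rewrite /msum big_seq; apply: (big_ind (fun y => exists x, psi x = y)) => //.
  by exists 0; rewrite /psi /= !mulr0n addr0.
by move=> _ _ [x <-] [z <-]; exists (x + z); rewrite psiD.
Qed.

Section FourGen.
Variables (G : zmodType) (e : G).
Hypotheses (e4 : e *+ 4 = 0) (e2 : e + e <> 0).
Implicit Types (ts xs : seq G) (h : G) (c : nat -> nat) (k : nat).

Definition comb ts c k := e *+ k + \sum_(i < size ts) ts`_i *+ c i.
Definition spanned ts h := exists k c, h = comb ts c k.
Definition indep ts := forall k c, comb ts c k = 0 ->
  (4 %| k)%N /\ forall i, (i < size ts)%N -> ~~ odd (c i).

Lemma combD ts c k c' k' :
  comb ts c k + comb ts c' k' = comb ts (fun i => c i + c' i)%N (k + k').
Proof.
rewrite /comb addrACA -mulrnDr -big_split; congr (_ + _).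
by apply: eq_bigr => i _; rewrite mulrnDr.
Qed.

Lemma spanned_add ts x y : spanned ts x -> spanned ts y -> spanned ts (x + y).
Proof.
by move=> [k [c ->]] [k' [c' ->]]; rewrite combD; eexists; eexists.
Qed.

Lemma comb0 ts k : comb ts (fun=> 0%N) k = e *+ k.
Proof. by rewrite /comb big1 ?addr0. Qed.

Lemma spanned_e ts k : spanned ts (e *+ k).
Proof. by exists k, (fun=> 0%N); rewrite comb0. Qed.

Lemma comb_cons t ts c k : comb (t :: ts) c k = t *+ c 0%N + comb ts (fun i => c i.+1) k.
Proof. by rewrite /comb /= big_ord_recl /= addrCA. Qed.

Lemma order2_odd (x : G) k : x + x = 0 -> x *+ k = if odd k then x else 0.
Proof.
move=> x2; rewrite -{1}[k]odd_double_half mulrnDr -mul2n mulrnA mulr2n x2.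
by rewrite mul0rn addr0; case: (odd k).
Qed.

(** Elements of order two are added to the independent family as long as they are
not spanned by it. *)
Lemma ex_basis xs : (forall x, x \in xs -> x + x = 0) ->
  exists ts, [/\ forall t, t \in ts -> t + t = 0, indep ts &
    forall x, x \in xs -> spanned ts x].
Proof.
elim: xs => [|x xs IH] H2.
  exists [::]; split=> // k c; rewrite /comb big_ord0 addr0 => ek; split=> //.
  move: (gcdn 4 k) (dvdn_gcdl 4 k) (dvdn_gcdr 4 k) (mulrn_gcd e4 ek) => d d4 dk ed.
  have : (d <= 4)%N by apply: dvdn_leq.
  case: d d4 dk ed => [|[|[|[|[|d]]]]] // _ dk ed _; case: e2.
    by rewrite -mulr2n -[2%N]/(1 * 2)%N mulrnA ed mul0rn.
have [x' x'P|ts [t2 it sp]] := IH; first by apply: H2; rewrite inE x'P orbT.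
have x2 : x + x = 0 by apply: H2; rewrite mem_head.
have [sx|nsx] := pselect (spanned ts x).
  by exists ts; split=> // y; rewrite inE => /orP[/eqP ->|/sp].
exists (x :: ts); split.
- by move=> t; rewrite inE => /orP[/eqP ->|/t2].
- move=> k c; rewrite comb_cons (order2_odd _ x2).
  case oc : (odd (c 0%N)) => z.
    case: nsx; exists k, (fun i => c i.+1).
    by apply: (addrI x); rewrite z.
  have [|k4 ci] := it k (fun i => c i.+1); first by rewrite add0r in z.
  by split=> // -[|i] /=; rewrite ?oc //; apply: ci.
have sub y : spanned ts y -> spanned (x :: ts) y.
  move=> [k [c ->]]; exists k, (fun i => if i is i'.+1 then c i' else 0%N).
  by rewrite comb_cons add0r.
move=> y; rewrite inE => /orP[/eqP ->|/sp/sub//].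
exists 0%N, (fun i => if i is i'.+1 then 0%N else 1%N).
by rewrite comb_cons comb0 addr0.
Qed.

(** The number of summands of order two is left open; it is found afterwards from
the Davenport constant. *)
Lemma order4_order2_sum xs : (forall x, x \in xs -> x + x = 0) ->
  (forall ts, (forall x, x \in xs -> spanned ts x) -> forall h, spanned ts h) ->
  exists2 r, (0 < r)%N & exists psi : C2pow_C4 r -> G,
    [/\ forall x y, psi (x + y) = psi x + psi y, injective psi &
        forall y, exists x, psi x = y].
Proof.
move=> xs2 gen; have [ts [t2 it sp]] := ex_basis xs2.
have {sp}gen := gen ts sp.
exists (size ts).+1 => //.
have em : ((size ts).+1 - 1 = size ts)%N by rewrite subn1.
rewrite /C2pow_C4; move: (_ - 1)%N em => m em.
pose psi (x : ({ffun 'I_m -> 'Z_2} * 'Z_4)%type) : G :=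
  e *+ x.2 + \sum_(i < m) ts`_i *+ x.1 i.
have tm (i : 'I_m) : ts`_i *+ 2 = 0.
  by rewrite mulr2n; apply: t2; rewrite mem_nth // -em.
have psiD x y : psi (x + y) = psi x + psi y.
  rewrite /psi mulrn_ZpD // addrACA -big_split; congr (_ + _).
  by apply: eq_bigr => i _; rewrite ffunE mulrn_ZpD.
have psi_comb x : psi x = comb ts (fun i => oapp (fun j : 'I_m => x.1 j : nat) 0%N (insub i)) x.2.
  rewrite /psi /comb -em; congr (_ + _); apply: eq_bigr => i _.
  by rewrite valK.
have psi0 x : psi x = 0 -> x = 0.
  rewrite psi_comb => /it[k4 ci]; case: x k4 ci => x1 x2 /= k4 ci.
  congr (_, _).
    apply/ffunP => i; rewrite ffunE; have := ci i; rewrite -em ltn_ord valK /= => /(_ isT).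
    by case: (x1 i) => [[|[|]]] // ? _; apply: val_inj.
  by case: x2 k4 => [[|[|[|[|]]]]] // ? _; apply: val_inj.
exists psi; split=> //.
- move=> x y exy; apply/eqP; rewrite -subr_eq0; apply/eqP/psi0.
  by apply: (addIr (psi y)); rewrite -psiD subrK exy add0r.
move=> y; have [k [c ->]] := gen y.
exists ([ffun i : 'I_m => inZp (c i)], inZp k); rewrite /psi /comb /=.
rewrite (@mulrn_mod _ e 4) // -em; congr (_ + _); apply: eq_bigr => i _.
by rewrite ffunE (@mulrn_mod _ _ 2).
Qed.

End FourGen.

Section Transport.
Variables (G H : zmodType) (psi : H -> G) (phi : G -> H).
Hypotheses (psiD : forall x y, psi (x + y) = psi x + psi y).
Hypotheses (psiK : cancel psi phi) (phiK : cancel phi psi).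

Definition mmap (A : {mset H}) : {mset G} := seq_mset (map psi A).

Lemma mmapE A y : mmap A y = A (phi y).
Proof.
rewrite /mmap mset_seqE count_map -count_mem_mset; apply: eq_count => x /=.
by rewrite -(inj_eq (can_inj phiK)) psiK.
Qed.

Lemma size_mmap A : size (mmap A) = size A.
Proof. by rewrite (perm_size (perm_eq_seq_mset _)) size_map. Qed.

Lemma msum_mmap A : msum (mmap A) = psi (msum A).
Proof.
have psi0 : psi 0 = 0 by apply: (addrI (psi 0)); rewrite -psiD !addr0.
rewrite /msum (perm_big _ (perm_eq_seq_mset _)) /= big_map.
by rewrite (big_morph psi psiD psi0).
Qed.

End Transport.

Lemma atom_mmap (G H : zmodType) (psi : H -> G) (phi : G -> H) U :
  (forall x y, psi (x + y) = psi x + psi y) -> cancel psi phi -> cancel phi psi ->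
  atom U -> atom (mmap psi U).
Proof.
move=> psiD psiK phiK /atomP[zU U0 minU].
have psi0 : psi 0 = 0 by apply: (addrI (psi 0)); rewrite -psiD !addr0.
have phiD x y : phi (x + y) = phi x + phi y.
  by apply: (can_inj psiK); rewrite psiD !phiK.
have phi0 : phi 0 = 0 by apply: (can_inj psiK); rewrite psi0 phiK.
have mK T : mmap psi (mmap phi T) = T.
  by apply/msetP => x; rewrite (mmapE psiK phiK) (mmapE phiK psiK) phiK.
apply/atomP; split.
- by rewrite msum_mmap // zU.
- have [x Ux] := mset_ex U0; apply: (@neq0_count _ (psi x)).
  by rewrite (mmapE psiK phiK) psiK.
move=> T /msubsetP le zT T0; rewrite -[T]mK; congr mmap; apply: minU.
- apply/msubsetP => x; have := le (psi x).
  by rewrite (mmapE phiK psiK) (mmapE psiK phiK) psiK.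
- by rewrite msum_mmap // zT.
by move=> e; apply: T0; rewrite -[T]mK e; apply/msetP => x; rewrite (mmapE psiK phiK) !mset0E.
Qed.

(** The group is C_2^(r'-1) + C_4 for some r', and comparing the lengths of atoms
on both sides gives r' = r. *)
Lemma isomorphic_C2pow_C4 (G : zmodType) r (U : {mset G}) (e : G) : (2 <= r)%N ->
  atom U -> davenport_le G (r + 3) -> size U = (r + 3)%N ->
  e *+ 4 = 0 -> e + e <> 0 ->
  (forall x, (0 < U x)%N -> [\/ x = e, x + x = 0 | (x + e) + (x + e) = 0]) ->
  zmod_isomorphic G (C2pow_C4 r).
Proof.
move=> r2 aU dG sU e4 e2 HU.
have D3 : (3 <= r + 3)%N by lia.
pose xs := [seq x <- U | x + x == 0] ++
  [seq x + e | x <- [seq x <- U | x + e + (x + e) == 0]].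
have xs2 x : x \in xs -> x + x = 0.
  rewrite mem_cat => /orP[|/mapP[y + ->]]; rewrite mem_filter => /andP[/eqP //].
have gen ts : (forall x, x \in xs -> spanned e ts x) -> forall h, spanned e ts h.
  move=> sp h; have [j Uj] : exists j, (0 < U j)%N by apply: mset_ex; case: aU.
  have [Y leY <-] := subsum dG aU sU D3 h Uj.
  have mem x : x \in Y -> spanned e ts x.
    move=> xY; have Ux : (0 < U x)%N.
      by have := msubsetP leY x; rewrite msetB1E; move: xY; rewrite -mset_gt0; lia.
    have xU : x \in enum_mset U by rewrite -[_ \in _]mset_gt0.
    case: (HU x Ux) => [->|x2|x2].
    - by have := spanned_e e ts 1; rewrite mulr1n.
    - by apply: sp; rewrite mem_cat mem_filter x2 eqxx xU.
    have -> : x = (x + e) + e *+ 3 by rewrite -addrA -mulrS e4 addr0.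
    apply: spanned_add (spanned_e _ _ _); apply: sp; rewrite mem_cat.
    by apply/orP; right; apply/mapP; exists x; rewrite // mem_filter x2 eqxx.
  rewrite /msum big_seq; apply: (big_ind (spanned e ts)) => //.
    by have := spanned_e e ts 0; rewrite mulr0n.
  exact: spanned_add.
have [r' r'0 [psi [psiD inj surj]]] := order4_order2_sum e4 e2 xs2 gen.
have [phi phiK] := choice surj.
have psiK : cancel psi phi by move=> x; apply: inj; rewrite phiK.
have phiD x y : phi (x + y) = phi x + phi y.
  by apply: inj; rewrite psiD !phiK.
have le1 : (r + 3 <= r' + 3)%N.
  rewrite -sU -(size_mmap phi); apply: davenport_le_C2pow_C4 => //.
  exact: (atom_mmap phiD phiK psiK aU).
have r'2 : (2 <= r')%N by lia.
have [V [aV sV] _] := C2pow_C4_atom r'2.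
have le2 : (r' + 3 <= r + 3)%N.
  by rewrite -sV -(size_mmap psi); apply: dG; apply: (atom_mmap psiD psiK phiK aV).
have er : r' = r by lia.
by move: psi psiD inj surj {phi phiK psiK phiD V aV sV}; rewrite er; apply: zmod_isomorphic_of.
Qed.

End Iso.

Theorem corollary1p3 (G : zmodType) :
  (forall r : nat, (2 <= r)%N ->
     system_of_lengths G = system_of_lengths (C2pow_C4 r) ->
     zmod_isomorphic G (C2pow_C4 r)) /\
  (forall n : nat, (2 <= n)%N ->
     system_of_lengths G = system_of_lengths (C2_C2n n) ->
     zmod_isomorphic G (C2_C2n n)).
Proof.
split=> [r r2|n n2] eL.
  have D2 : (2 <= r + 3)%N by lia.
  have D3 : (3 <= r + 3)%N by lia.
  have dG : davenport_le G (r + 3).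
    by apply: (davenport_le_transfer eL) => //; apply: davenport_le_C2pow_C4; lia.
  have [V _ [zV HV]] := C2pow_C4_atom r2.
  have [S _ HS] := lengths_transfer eL zV.
  have {V zV HV} HS k : is_length S k <-> [\/ k = 2%N, k = 4%N | k = (r + 3)%N].
    by rewrite HS HV.
  have [||U [aU sU eS]] := extremal_product dG D3 (S := S).
  - by apply/HS; constructor 1.
  - by apply/HS; constructor 3.
  rewrite eS in HS.
  have [r3|r3] := leqP 3 r.
    have D6 : (6 <= r + 3)%N by lia.
    have [e [e4 e2 HU]] := shape_C2pow_C4 dG aU sU D6 HS.
    exact: (isomorphic_C2pow_C4 r2 aU dG sU e4 e2 HU).
  have er : r = 2%N by lia.
  subst r.
  have [f [g [f2 g4 g2 eU]]] := shape_C2_C2n dG aU sU isT HS.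
  apply: (isomorphic_C2pow_C4 (e := g) r2 aU dG sU g4 g2) => x.
  rewrite eU !msetE2 !mset1E msetnE.
  have [-> _|_] := eqVneq x f; first by constructor 2.
  have [-> _|_] := eqVneq x (g + f).
    constructor 3; have -> : g + f + g = g + g + f by rewrite addrAC.
    rewrite addrACA f2 addr0.
    by move: g4; rewrite -[(_).-1]/(2 + 2)%N mulrnDr mulr2n.
  by have [-> _|//] := eqVneq x g; constructor 1.
have D2 : (2 <= 2 * n + 1)%N by lia.
have D3 : (3 <= 2 * n + 1)%N by lia.
have D5 : (5 <= 2 * n + 1)%N by lia.
have dG : davenport_le G (2 * n + 1).
  by apply: (davenport_le_transfer eL) => //; apply: davenport_le_C2_C2n; lia.
have [V zV HV] := C2_C2n_set n2.
have [S _ HS] := lengths_transfer eL zV.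
have {V zV HV} HS k : is_length S k <-> [\/ k = 2%N, k = (2 * n + 1).-1 | k = (2 * n + 1)%N].
  by rewrite HS HV addn1.
have [||U [aU sU eS]] := extremal_product dG D3 (S := S).
- by apply/HS; constructor 1.
- by apply/HS; constructor 3.
rewrite eS in HS.
have [f [g [f2 gn g2 eU]]] := shape_C2_C2n dG aU sU D5 HS.
rewrite addn1 /= in gn eU.
exact: (isomorphic_C2_C2n n2 aU dG f2 gn eU).
Qed.
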